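(* Let $(\mathcal{C},\mathbb{E},\mathfrak{s})$ be an extriangulated category, let $(\mathcal{S},\mathcal{Z},\mathcal{V})$ be a premutation triple in $\mathcal{C}$, and put $\mathcal{I}=\mathcal{S}\cap\mathcal{Z}=\mathcal{Z}\cap\mathcal{V}$. Then the ideal quotient $\mathcal{Z}/[\mathcal{I}]$ has a pretriangulated structure; namely, $(\mathcal{Z}/[\mathcal{I}],\Sigma,\Omega,\nabla,\Delta)$, with $\Sigma,\Omega,\nabla,\Delta$ and the adjunction $(\Sigma,\Omega)$ as defined in the context, is a pretriangulated category.
   Context: **Conventions.** $\mathcal{C}$ is a skeletally small additive category; all subcategories are full, additive and closed under isomorphisms (not necessarily under direct summands). $(\mathcal{C},\mathbb{E},\mathfrak{s})$ is an extriangulated category in the sense of Nakaoka--Palu ($\mathbb{E}:\mathcal{C}^{\mathrm{op}}\times\mathcal{C}\to\mathrm{Ab}$ an additive bifunctor, $\mathfrak{s}$ an additive realization, satisfying (ET3), (ET3)$^{\mathrm{op}}$, (ET4), (ET4)$^{\mathrm{op}}$). If $\delta\in\mathbb{E}(Z,X)$ and $\mathfrak{s}(\delta)=[X\xrightarrow{x}Y\xrightarrow{y}Z]$, we write $X\xrightarrow{x}Y\xrightarrow{y}Z\overset{\delta}{\dashrightarrow}X$, an $\mathfrak{s}$-triangle; $X\to Y\to Z$ is an $\mathfrak{s}$-conflation, $x$ an $\mathfrak{s}$-inflation, $y$ an $\mathfrak{s}$-deflation. For $a:X\to X'$ and $b:Z'\to Z$ write $a\delta=\mathbb{E}(Z,a)(\delta)$,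 $\delta b=\mathbb{E}(b,X)(\delta)$. For subcategories $\mathcal{X},\mathcal{Y}$: $\mathrm{Cone}_{\mathbb{E}}(\mathcal{X},\mathcal{Y})$ is the class of $C$ admitting a conflation $X\to Y\to C$, and $\mathrm{CoCone}_{\mathbb{E}}(\mathcal{X},\mathcal{Y})$ the class of $C$ admitting a conflation $C\to X\to Y$, with $X\in\mathcal{X},Y\in\mathcal{Y}$. **Relative structures.** For a subcategory $\mathcal{I}$: $\mathbb{E}_{\mathcal{I}}(Z,X)=\{\delta\in\mathbb{E}(Z,X): \delta f=0\ \forall f:I\to Z, I\in\mathcal{I}\}$, $\mathbb{E}^{\mathcal{I}}(Z,X)=\{\delta: g\delta=0\ \forall g:X\to I, I\in\mathcal{I}\}$. With the restrictions $\mathfrak{s}_{\mathcal{I}},\mathfrak{s}^{\mathcal{I}}$ of $\mathfrak{s}$ these give extriangulated categories; $\mathrm{Cone}_{\mathbb{E}^{\mathcal{I}}}$, $\mathrm{CoCone}_{\mathbb{E}_{\mathcal{I}}}$, etc. are taken in them. **Approximations.** $f:X\to I^X$ with $I^X\in\mathcal{I}$ is a left $\mathcal{I}$-approximation if every morphism from $X$ to an object of $\mathcal{I}$ factors through $f$; right approximations are dual. A subcategory $\mathcal{I}$ closed under direct summands is strongly covariantly (resp. contravariantly) finite in $\mathcal{Z}$ if every object of $\mathcal{Z}$ has a left (resp. right) $\mathcal{I}$-approximation that is an $\mathfrak{s}$-inflation (resp. $\mathfrak{s}$-deflation); strongly functorially finite means both. $[\mathcal{I}]$ is the ideal of morphisms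 factoring through an object of $\mathcal{I}$; $\underline{f}$ is the class of $f$ in $\mathcal{C}/[\mathcal{I}]$. **Premutation triple.** A triple $(\mathcal{S},\mathcal{Z},\mathcal{V})$ of subcategories of $\mathcal{C}$ such that: (MT1) $\mathcal{S}\cap\mathcal{Z}=\mathcal{Z}\cap\mathcal{V}=:\mathcal{I}$, and $\mathcal{I}$ is strongly functorially finite in $\mathcal{Z}$. (MT2) $\mathbb{E}^{\mathcal{I}}(\mathcal{S},\mathcal{Z})=0$, $\mathbb{E}_{\mathcal{I}}(\mathcal{S},\mathcal{Z}\langle-1\rangle)=0$, $\mathbb{E}_{\mathcal{I}}(\mathcal{Z},\mathcal{V})=0$, $\mathbb{E}^{\mathcal{I}}(\mathcal{Z}\langle1\rangle,\mathcal{V})=0$, where $\mathcal{Z}\langle1\rangle=\mathrm{Cone}_{\mathbb{E}^{\mathcal{I}}}(\mathcal{Z},\mathcal{I})$, $\mathcal{Z}\langle-1\rangle=\mathrm{CoCone}_{\mathbb{E}_{\mathcal{I}}}(\mathcal{I},\mathcal{Z})$. (MT3) $\mathrm{Cone}_{\mathbb{E}^{\mathcal{I}}}(\mathcal{Z},\mathcal{Z})\subset\widetilde{\mathcal{U}}:=\mathrm{CoCone}_{\mathbb{E}^{\mathcal{I}}}(\mathcal{Z},\mathcal{S})$; $\mathrm{CoCone}_{\mathbb{E}_{\mathcal{I}}}(\mathcal{Z},\mathcal{Z})\subset\widetilde{\mathcal{T}}:=\mathrm{Cone}_{\mathbb{E}_{\mathcal{I}}}(\mathcal{V},\mathcal{Z})$;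 $\mathcal{S},\mathcal{Z}$ are closed under extensions in $(\mathcal{C},\mathbb{E}^{\mathcal{I}},\mathfrak{s}^{\mathcal{I}})$ and $\mathcal{V},\mathcal{Z}$ are closed under extensions in $(\mathcal{C},\mathbb{E}_{\mathcal{I}},\mathfrak{s}_{\mathcal{I}})$. **Functors.** For $X\in\mathcal{Z}$ fix an $\mathfrak{s}^{\mathcal{I}}$-triangle $X\xrightarrow{i^X}I^X\xrightarrow{p^X}X\langle1\rangle\overset{\lambda^X}{\dashrightarrow}X$ with $i^X$ a left $\mathcal{I}$-approximation; for $x:X\to X'$ in $\mathcal{Z}$ choose $x\langle1\rangle$ with $\lambda^{X'}x\langle1\rangle=x\lambda^X$. For $U\in\widetilde{\mathcal{U}}$ fix an $\mathfrak{s}^{\mathcal{I}}$-triangle $U\xrightarrow{h^U}\sigma U\to S^U\dashrightarrow U$ with $\sigma U\in\mathcal{Z}$, $S^U\in\mathcal{S}$ (with $\sigma U=U$, $h^U=\mathrm{id}$ if $U\in\mathcal{Z}$); for $u:U\to U'$ choose $\sigma(u)$ with $\sigma(u)h^U=h^{U'}u$. These induce well-defined additive functors $\langle1\rangle:\mathcal{Z}/[\mathcal{I}]\to\widetilde{\mathcal{U}}/[\mathcal{I}]$, $\sigma:\widetilde{\mathcal{U}}/[\mathcal{I}]\to\mathcal{Z}/[\mathcal{I}]$, and $\Sigma:=\sigma\circ\langle1\rangle$. Dually, for $X\in\mathcal{Z}$ fix an $\mathfrak{s}_{\mathcal{I}}$-triangle $X\langle-1\rangle\xrightarrow{i_X}I_X\xrightarrow{p_X}X\overset{\lambda_X}{\dashrightarrow}X\langle-1\rangle$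 with $p_X$ a right $\mathcal{I}$-approximation, and $x\langle-1\rangle$ with $x\langle-1\rangle\lambda_X=\lambda_{X'}x$; for $T\in\widetilde{\mathcal{T}}$ fix an $\mathfrak{s}_{\mathcal{I}}$-triangle $V_T\to\omega T\xrightarrow{h_T}T\dashrightarrow V_T$ with $\omega T\in\mathcal{Z}$, $V_T\in\mathcal{V}$ (with $\omega T=T$, $h_T=\mathrm{id}$ if $T\in\mathcal{Z}$), and $\omega(t)$ with $h_{T'}\omega(t)=t h_T$. Put $\Omega:=\omega\circ\langle-1\rangle$. **Adjunction.** $(\Sigma,\Omega)$ is an adjoint pair: the classes of $f:Z\to\Omega Z'$ and $f':\Sigma Z\to Z'$ correspond iff $h_{Z'\langle-1\rangle}f\lambda^Z=-\lambda_{Z'}f'h^{Z\langle1\rangle}$. Its unit is $\alpha$, counit $\beta$. **Triangles.** For $a:X\to Y$ in $\mathcal{Z}$ choose an $\mathfrak{s}^{\mathcal{I}}$-triangle $X\xrightarrow{\binom{a}{i^X}}Y\oplus I^X\xrightarrow{\tilde b}C^a\overset{\tilde\delta}{\dashrightarrow}X$, let $b=\tilde b\binom{1}{0}$ and let $c^a:C^a\to X\langle1\rangle$ satisfy $\lambda^Xc^a=\tilde\delta$. The standard right triangle of $\underline{a}$ is $X\xrightarrow{\underline a}Y\xrightarrow{\underline{h^{C^a}b}}\sigma C^a\xrightarrow{\sigma(\underline{c^a})}\Sigma X$; $\nabla$ consists of all sequences in $\mathcal{Z}/[\mathcal{I}]$ isomorphic to standard right triangles. For $b:Y\to Z$ in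 $\mathcal{Z}$ choose an $\mathfrak{s}_{\mathcal{I}}$-triangle $C_b\xrightarrow{\hat a}Y\oplus I_Z\xrightarrow{(b\ p_Z)}Z\overset{\hat\delta}{\dashrightarrow}C_b$, let $a=(1\ 0)\hat a$ and $c_b:Z\langle-1\rangle\to C_b$ with $c_b\lambda_Z=\hat\delta$. The standard left triangle is $\Omega Z\xrightarrow{\omega(\underline{c_b})}\omega C_b\xrightarrow{\underline{ah_{C_b}}}Y\xrightarrow{\underline b}Z$; $\Delta$ consists of all sequences isomorphic to standard left triangles. **Pretriangulated categories (Beligiannis--Reiten).** A right triangulated category $(\mathcal{A},\Sigma,\nabla)$: $\mathcal{A}$ additive, $\Sigma$ an additive endofunctor, $\nabla$ a class of sequences $X\to Y\to Z\to\Sigma X$ such that (rTR0) $\nabla$ is closed under isomorphisms (triples $(x,y,z)$ with last component $\Sigma x$); (rTR1) $X\xrightarrow{\mathrm{id}}X\to0\to\Sigma X$ is in $\nabla$ and every $f:X\to Y$ is the first map of some element of $\nabla$; (rTR2) $(f,g,h)\in\nabla$ implies $(g,h,-\Sigma f)\in\nabla$; (rTR3) for $(f_i,g_i,h_i)\in\nabla$ ($i=1,2$) and $x,y$ with $yf_1=f_2x$ there is $z$ with $zg_1=g_2y$, $h_2z=\Sigma x\circ h_1$; (rTR4) if $a''=a'a$ and $X\xrightarrow{a}Y\xrightarrow{b}C\xrightarrow{c}\Sigma X$, $Y\xrightarrow{a'}Z\xrightarrow{b'}D\xrightarrow{c'}\Sigma Y$, $X\xrightarrow{a''}Z\xrightarrow{b''}E\xrightarrow{c''}\Sigma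 X$ are in $\nabla$, there is $C\xrightarrow{s}E\xrightarrow{t}D\xrightarrow{u}\Sigma C$ in $\nabla$ with $sb=b''a'$, $c''s=c$, $tb''=b'$, $u=\Sigma b\circ c'$, $c't=\Sigma a\circ c''$. A left triangulated category $(\mathcal{A},\Omega,\Delta)$ is defined dually, with sequences $\Omega Z\to X\to Y\to Z$. $(\mathcal{A},\Sigma,\Omega,\nabla,\Delta)$ is pretriangulated if $(\Sigma,\Omega)$ is an adjoint pair (unit $\alpha$, counit $\beta$), $(\mathcal{A},\Sigma,\nabla)$ is right triangulated, $(\mathcal{A},\Omega,\Delta)$ is left triangulated, and for every $X_1\xrightarrow{f_1}Y_1\xrightarrow{g_1}Z_1\xrightarrow{h_1}\Sigma X_1$ in $\nabla$ and $\Omega Z_2\xrightarrow{h_2'}X_2\xrightarrow{f_2}Y_2\xrightarrow{g_2}Z_2$ in $\Delta$: (a) if $s:X_1\to\Omega Z_2$, $t:Y_1\to X_2$ satisfy $tf_1=h_2's$, there is $u:Z_1\to Y_2$ with $ug_1=f_2t$ and $g_2u=\beta_{Z_2}\Sigma(s)h_1$; (b) if $t':Z_1\to Y_2$, $u':\Sigma X_1\to Z_2$ satisfy $u'h_1=g_2t'$, there is $s':Y_1\to X_2$ with $s'f_1=h_2'\Omega(u')\alpha_{X_1}$ and $f_2s'=t'g_1$. *)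

(* Defs.v *)
From HB Require Import structures.
From mathcomp Require Import all_boot all_algebra.
From mathcomp Require Import boolp.

Set Implicit Arguments.
Unset Strict Implicit.
Unset Printing Implicit Defensive.

Import GRing.Theory.
Local Open Scope ring_scope.
Local Open Scope quotient_scope.

Record preaddcat := PreAddCat {
  ob :> Type;
  hom : ob -> ob -> zmodType;
  idm : forall X, hom X X;
  comp : forall X Y Z, hom Y Z -> hom X Y -> hom X Z;
  compA : forall X Y Z W (h : hom Z W) (g : hom Y Z) (f : hom X Y),
    comp h (comp g f) = comp (comp h g) f;
  comp1m : forall X Y (f : hom X Y), comp (idm Y) f = f;
  compm1 : forall X Y (f : hom X Y), comp f (idm X) = f;
  compDl : forall X Y Z (g g' : hom Y Z) (f : hom X Y),
    comp (g + g') f = comp g f + comp g' f;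
  compDr : forall X Y Z (g : hom Y Z) (f f' : hom X Y),
    comp g (f + f') = comp g f + comp g f' }.

Arguments hom {p} X Y.
Arguments idm {p} X.
Arguments comp {p X Y Z} g f.

Notation "g \oc f" := (comp g f) (at level 40, left associativity) : ring_scope.

Section CompZero.
Variable C : preaddcat.

Lemma comp0m (X Y Z : C) (f : hom X Y) : (0 : hom Y Z) \oc f = 0.
Proof. by apply: (addrI (0 \oc f)); rewrite -compDl !addr0. Qed.

Lemma compm0 (X Y Z : C) (g : hom Y Z) : g \oc (0 : hom X Y) = 0.
Proof. by apply: (addrI (g \oc 0)); rewrite -compDr !addr0. Qed.

Lemma compNm (X Y Z : C) (g : hom Y Z) (f : hom X Y) : (- g) \oc f = - (g \oc f).
Proof. by apply/eqP; rewrite -addr_eq0 -compDl addNr comp0m. Qed.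

Lemma compmN (X Y Z : C) (g : hom Y Z) (f : hom X Y) : g \oc (- f) = - (g \oc f).
Proof. by apply/eqP; rewrite -addr_eq0 -compDr addNr compm0. Qed.

End CompZero.

Definition is_iso (C : preaddcat) (X Y : C) (f : hom X Y) : Prop :=
  exists g : hom Y X, g \oc f = idm X /\ f \oc g = idm Y.

Definition isomorphic (C : preaddcat) (X Y : C) : Prop :=
  exists f : hom X Y, is_iso f.

Definition is_zero (C : preaddcat) (X : C) : Prop := idm X = 0.

Record biprod (C : preaddcat) (X Y : C) := Biprod {
  bp_ob :> C;
  bin1 : hom X bp_ob;
  bin2 : hom Y bp_ob;
  bpr1 : hom bp_ob X;
  bpr2 : hom bp_ob Y;
  bpr1_in1 : bpr1 \oc bin1 = idm X;
  bpr2_in2 : bpr2 \oc bin2 = idm Y;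
  bpr1_in2 : bpr1 \oc bin2 = 0;
  bpr2_in1 : bpr2 \oc bin1 = 0;
  bp_id : bin1 \oc bpr1 + bin2 \oc bpr2 = idm bp_ob }.

Definition additive (C : preaddcat) : Prop :=
  (exists O : C, is_zero O) /\ (forall X Y : C, inhabited (biprod X Y)).

Record addcat := AddCat { ac_base :> preaddcat; ac_additive : additive ac_base }.

(* Carriers of MathComp structures play the role of (small) sets here, as they
   do for the groups [hom X Y]; the objects may live in a larger universe. *)
Definition skeletally_small (C : preaddcat) : Prop :=
  exists (T : choiceType) (F : T -> C), forall X : C, exists t, isomorphic (F t) X.

Definition opcat (C : preaddcat) : preaddcat :=
  @PreAddCat (ob C) (fun X Y => @hom C Y X) (@idm C)
    (fun X Y Z g f => @comp C Z Y X f g)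
    (fun X Y Z W h g f => esym (@compA C W Z Y X f g h))
    (fun X Y f => @compm1 C Y X f)
    (fun X Y f => @comp1m C Y X f)
    (fun X Y Z g g' f => @compDr C Z Y X f g g')
    (fun X Y Z g f f' => @compDl C Z Y X f f' g).

(* Full subcategories, additive and closed under isomorphisms *)
Record subcat (C : preaddcat) := Subcat {
  in_sub :> C -> Prop;
  sub_iso : forall X Y : C, isomorphic X Y -> in_sub X -> in_sub Y;
  sub_zero : forall O : C, is_zero O -> in_sub O;
  sub_biprod : forall (X Y : C) (B : biprod X Y),
    in_sub X -> in_sub Y -> in_sub B }.

Section SubcatI.
Variables (C : preaddcat) (P Q : subcat C).

Definition subcatI : subcat C.
Proof.
refine (@Subcat C (fun X => P X /\ Q X) _ _ _).
- by move=> X Y XY [PX QX]; split; [exact: (sub_iso XY) | exact: (sub_iso XY)].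
- by move=> O O0; split; exact: sub_zero.
- by move=> X Y B [PX QX] [PY QY]; split; exact: sub_biprod.
Defined.

End SubcatI.

Definition summand_closed (C : preaddcat) (P : subcat C) : Prop :=
  forall (X Y : C) (B : biprod X Y), P B -> P X.

(* The action on objects is a parameter, so that for the functors below it holds
   by definition. *)
Record addfunctor (A B : preaddcat) (F : A -> B) := AddFunctor {
  fmap :> forall X Y : A, hom X Y -> hom (F X) (F Y);
  fmap1 : forall X, fmap (idm X) = idm (F X);
  fmapM : forall X Y Z (g : hom Y Z) (f : hom X Y),
    fmap (g \oc f) = fmap g \oc fmap f;
  fmapD : forall X Y (f g : hom X Y), fmap (f + g) = fmap f + fmap g }.

Arguments fmap {A B F} a {X Y} f.

Definition fcomp (A B D : preaddcat) (F : A -> B) (G : B -> D)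
  (Gm : addfunctor G) (Fm : addfunctor F) : addfunctor (fun X => G (F X)).
Proof.
refine (@AddFunctor A D (fun X => G (F X))
          (fun X Y f => fmap Gm (fmap Fm f)) _ _ _).
- by move=> X; rewrite !fmap1.
- by move=> X Y Z g f; rewrite !fmapM.
- by move=> X Y f g; rewrite !fmapD.
Defined.

Definition opfunctor (A B : preaddcat) (F : A -> B) (Fm : addfunctor F) :
  @addfunctor (opcat A) (opcat B) F :=
  @AddFunctor (opcat A) (opcat B) F (fun X Y f => @fmap A B F Fm Y X f)
    (@fmap1 _ _ _ Fm)
    (fun X Y Z g f => @fmapM _ _ _ Fm Z Y X f g)
    (fun X Y f g => @fmapD _ _ _ Fm Y X f g).

(* [L] is left adjoint to [R] *)
Record adjunction (A B : preaddcat) (L : A -> B) (R : B -> A)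
    (Lm : addfunctor L) (Rm : addfunctor R) := Adjunction {
  adj_r : forall (X : A) (Y : B), hom (L X) Y -> hom X (R Y);
  adj_l : forall (X : A) (Y : B), hom X (R Y) -> hom (L X) Y;
  adj_rK : forall X Y (f : hom (L X) Y), adj_l (adj_r f) = f;
  adj_lK : forall X Y (f : hom X (R Y)), adj_r (adj_l f) = f;
  adj_natl : forall X' X Y (f : hom (L X) Y) (x : hom X' X),
    adj_r (f \oc fmap Lm x) = adj_r f \oc x;
  adj_natr : forall X Y Y' (f : hom (L X) Y) (y : hom Y Y'),
    adj_r (y \oc f) = fmap Rm y \oc adj_r f }.

Section UnitCounit.
Variables (A B : preaddcat) (L : A -> B) (R : B -> A).
Variables (Lm : addfunctor L) (Rm : addfunctor R) (adj : adjunction Lm Rm).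

Definition adj_unit (X : A) : hom X (R (L X)) := adj_r adj (idm (L X)).
Definition adj_counit (Y : B) : hom (L (R Y)) Y := adj_l adj (idm (R Y)).

End UnitCounit.

Record subob (C : preaddcat) (P : C -> Prop) := Subob { so_ob :> C; so_in : P so_ob }.

Section IdealQuotient.
Variables (C : addcat) (I : subcat C).

Definition factors (X Y : C) (f : hom X Y) : Prop :=
  exists (W : C) (g : hom X W) (h : hom W Y), I W /\ f = h \oc g.

Definition ideal (X Y : C) : {pred hom X Y} := fun f => `[< factors f >].

Lemma ideal_zmod_closed (X Y : C) : zmod_closed (@ideal X Y).
Proof.
have [[O O0] bp] := ac_additive C; split.
  apply/asboolP; exists O, 0, 0; split; first exact: sub_zero.
  by rewrite comp0m.
move=> f f' /asboolP[W [g [h [IW ->]]]] /asboolP[W' [g' [h' [IW' ->]]]].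
have [B] := bp W W'; apply/asboolP.
exists B, (bin1 B \oc g + bin2 B \oc g'), (h \oc bpr1 B - h' \oc bpr2 B).
split; first exact: sub_biprod.
have e1 : bpr1 B \oc (bin1 B \oc g + bin2 B \oc g') = g.
  by rewrite compDr !compA bpr1_in1 bpr1_in2 comp1m comp0m addr0.
have e2 : bpr2 B \oc (bin1 B \oc g + bin2 B \oc g') = g'.
  by rewrite compDr !compA bpr2_in2 bpr2_in1 comp1m comp0m add0r.
by rewrite compDl compNm -!compA e1 e2.
Qed.

HB.instance Definition _ (X Y : C) :=
  GRing.isZmodClosed.Build (hom X Y) (@ideal X Y) (@ideal_zmod_closed X Y).

Definition qhom (X Y : C) : zmodType := Quotient.quot (@ideal X Y).

Definition qpi (X Y : C) (f : hom X Y) : qhom X Y := \pi f.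
Definition qrepr (X Y : C) (f : qhom X Y) : hom X Y :=
  repr (f : Quotient.quot (@ideal X Y)).

Lemma qreprK (X Y : C) (f : qhom X Y) : qpi (qrepr f) = f.
Proof. exact: reprK. Qed.

Lemma qpi_eq (X Y : C) (f g : hom X Y) : qpi f = qpi g <-> factors (f - g).
Proof.
split=> [/eqP|fg].
  by rewrite /qpi -Quotient.idealrBE => /asboolP.
by apply/eqP; rewrite /qpi -Quotient.idealrBE; apply/asboolP.
Qed.

Lemma qpiD (X Y : C) (f g : hom X Y) : qpi (f + g) = qpi f + qpi g.
Proof. by rewrite /qpi raddfD. Qed.

Definition qcomp (X Y Z : C) (g : qhom Y Z) (f : qhom X Y) : qhom X Z :=
  qpi (qrepr g \oc qrepr f).

Lemma qcompE (X Y Z : C) (g : hom Y Z) (f : hom X Y) :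
  qcomp (qpi g) (qpi f) = qpi (g \oc f).
Proof.
rewrite /qcomp.
have [W [u [v [IW e]]]] : factors (qrepr (qpi g) - g).
  by apply/qpi_eq; rewrite qreprK.
have [W' [u' [v' [IW' e']]]] : factors (qrepr (qpi f) - f).
  by apply/qpi_eq; rewrite qreprK.
transitivity (qpi (g \oc qrepr (qpi f))); apply/qpi_eq.
  exists W, (u \oc qrepr (qpi f)), v; split=> //.
  by rewrite compA -e compDl compNm.
by exists W', u', (g \oc v'); split; rewrite // -compA -e' compDr compmN.
Qed.

Variable P : C -> Prop.

(* P/[I], for the full subcategory on the objects satisfying [P] *)
Definition idquot : preaddcat.
Proof.
refine (@PreAddCat (subob P) (fun X Y => qhom X Y) (fun X => qpi (idm (X : C)))
          (fun X Y Z g f => qcomp g f) _ _ _ _ _).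
- move=> X Y Z W h g f; rewrite -(qreprK h) -(qreprK g) -(qreprK f).
  by rewrite !qcompE compA.
- by move=> X Y f; rewrite -(qreprK f) qcompE comp1m.
- by move=> X Y f; rewrite -(qreprK f) qcompE compm1.
- move=> X Y Z g g' f; rewrite -(qreprK g) -(qreprK g') -(qreprK f).
  by rewrite -qpiD !qcompE compDl qpiD.
- move=> X Y Z g f f'; rewrite -(qreprK g) -(qreprK f') -(qreprK f).
  by rewrite -qpiD !qcompE compDr qpiD.
Defined.

Definition cls (X Y : subob P) (f : hom (X : C) (Y : C)) : @hom idquot X Y := qpi f.

End IdealQuotient.

Arguments cls {C} I {P X Y} f.

Definition rseqs (A : preaddcat) (Sg : A -> A) : Type :=
  forall X Y Z : A, hom X Y -> hom Y Z -> hom Z (Sg X) -> Prop.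

Definition lseqs (A : preaddcat) (Om : A -> A) : Type :=
  forall X Y Z : A, hom (Om Z) X -> hom X Y -> hom Y Z -> Prop.

Definition rseq_iso (A : preaddcat) (Sg : A -> A) (Sm : addfunctor Sg)
    (X Y Z : A) (f : hom X Y) (g : hom Y Z) (h : hom Z (Sg X))
    (X' Y' Z' : A) (f' : hom X' Y') (g' : hom Y' Z') (h' : hom Z' (Sg X')) : Prop :=
  exists (x : hom X X') (y : hom Y Y') (z : hom Z Z'),
    [/\ is_iso x, is_iso y & is_iso z] /\
    [/\ y \oc f = f' \oc x, z \oc g = g' \oc y & fmap Sm x \oc h = h' \oc z].

Definition lseq_iso (A : preaddcat) (Om : A -> A) (Omm : addfunctor Om)
    (X Y Z : A) (h : hom (Om Z) X) (f : hom X Y) (g : hom Y Z)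
    (X' Y' Z' : A) (h' : hom (Om Z') X') (f' : hom X' Y') (g' : hom Y' Z') : Prop :=
  exists (x : hom X X') (y : hom Y Y') (z : hom Z Z'),
    [/\ is_iso x, is_iso y & is_iso z] /\
    [/\ x \oc h = h' \oc fmap Omm z, y \oc f = f' \oc x & z \oc g = g' \oc y].

Record right_triangulated (A : preaddcat) (Sg : A -> A) (Sm : addfunctor Sg)
    (nab : rseqs Sg) : Prop := RightTriangulated {
  rt_additive : additive A;
  rTR0 : forall (X Y Z : A) (f : hom X Y) (g : hom Y Z) (h : hom Z (Sg X))
      (X' Y' Z' : A) (f' : hom X' Y') (g' : hom Y' Z') (h' : hom Z' (Sg X')),
    nab X Y Z f g h -> rseq_iso Sm f g h f' g' h' -> nab X' Y' Z' f' g' h';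
  rTR1_id : forall X O : A, is_zero O -> nab X X O (idm X) 0 0;
  rTR1_ex : forall (X Y : A) (f : hom X Y),
    exists (Z : A) (g : hom Y Z) (h : hom Z (Sg X)), nab X Y Z f g h;
  rTR2 : forall (X Y Z : A) (f : hom X Y) (g : hom Y Z) (h : hom Z (Sg X)),
    nab X Y Z f g h -> nab Y Z (Sg X) g h (- fmap Sm f);
  rTR3 : forall (X1 Y1 Z1 : A) (f1 : hom X1 Y1) (g1 : hom Y1 Z1) (h1 : hom Z1 (Sg X1))
      (X2 Y2 Z2 : A) (f2 : hom X2 Y2) (g2 : hom Y2 Z2) (h2 : hom Z2 (Sg X2))
      (x : hom X1 X2) (y : hom Y1 Y2),
    nab X1 Y1 Z1 f1 g1 h1 -> nab X2 Y2 Z2 f2 g2 h2 -> y \oc f1 = f2 \oc x ->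
    exists z : hom Z1 Z2, z \oc g1 = g2 \oc y /\ h2 \oc z = fmap Sm x \oc h1;
  rTR4 : forall (X Y Z C D E : A)
      (a : hom X Y) (b : hom Y C) (c : hom C (Sg X))
      (a' : hom Y Z) (b' : hom Z D) (c' : hom D (Sg Y))
      (a'' : hom X Z) (b'' : hom Z E) (c'' : hom E (Sg X)),
    a'' = a' \oc a -> nab X Y C a b c -> nab Y Z D a' b' c' -> nab X Z E a'' b'' c'' ->
    exists (s : hom C E) (t : hom E D) (u : hom D (Sg C)),
      nab C E D s t u /\
      [/\ s \oc b = b'' \oc a', c'' \oc s = c, t \oc b'' = b',
          u = fmap Sm b \oc c' & c' \oc t = fmap Sm a \oc c''] }.

(* A sequence Om Z -> X -> Y -> Z is read as Z -> Y -> X -> Om Z in the opposite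
   category. *)
Definition op_seqs (A : preaddcat) (Om : A -> A) (del : lseqs Om) :
    @rseqs (opcat A) Om :=
  fun X Y Z f g h => del Z Y X h g f.

Definition left_triangulated (A : preaddcat) (Om : A -> A) (Omm : addfunctor Om)
    (del : lseqs Om) : Prop :=
  right_triangulated (opfunctor Omm) (op_seqs del).

Record pretriangulated (A : preaddcat) (Sg Om : A -> A)
    (Sm : addfunctor Sg) (Omm : addfunctor Om) (adj : adjunction Sm Omm)
    (nab : rseqs Sg) (del : lseqs Om) : Prop := Pretriangulated {
  pt_right : right_triangulated Sm nab;
  pt_left : left_triangulated Omm del;
  pt_a : forall (X1 Y1 Z1 : A) (f1 : hom X1 Y1) (g1 : hom Y1 Z1) (h1 : hom Z1 (Sg X1))
      (X2 Y2 Z2 : A) (h2 : hom (Om Z2) X2) (f2 : hom X2 Y2) (g2 : hom Y2 Z2),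
    nab X1 Y1 Z1 f1 g1 h1 -> del X2 Y2 Z2 h2 f2 g2 ->
    forall (s : hom X1 (Om Z2)) (t : hom Y1 X2), t \oc f1 = h2 \oc s ->
    exists u : hom Z1 Y2, u \oc g1 = f2 \oc t /\
      g2 \oc u = adj_counit adj Z2 \oc fmap Sm s \oc h1;
  pt_b : forall (X1 Y1 Z1 : A) (f1 : hom X1 Y1) (g1 : hom Y1 Z1) (h1 : hom Z1 (Sg X1))
      (X2 Y2 Z2 : A) (h2 : hom (Om Z2) X2) (f2 : hom X2 Y2) (g2 : hom Y2 Z2),
    nab X1 Y1 Z1 f1 g1 h1 -> del X2 Y2 Z2 h2 f2 g2 ->
    forall (t : hom Z1 Y2) (u : hom (Sg X1) Z2), u \oc h1 = g2 \oc t ->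
    exists s : hom Y1 X2, s \oc f1 = h2 \oc fmap Omm u \oc adj_unit adj X1 /\
      f2 \oc s = t \oc g1 }.

Definition seq_equiv (C : preaddcat) (X Z Y Y' : C) (x : hom X Y) (y : hom Y Z)
    (x' : hom X Y') (y' : hom Y' Z) : Prop :=
  exists b : hom Y Y', [/\ is_iso b, b \oc x = x' & y' \oc b = y].

Definition bimap (C : preaddcat) (X X' Y Y' : C) (B : biprod X X') (D : biprod Y Y')
    (f : hom X Y) (f' : hom X' Y') : hom (B : C) (D : C) :=
  bin1 D \oc f \oc bpr1 B + bin2 D \oc f' \oc bpr2 B.

(* Extriangulated categories in the sense of Nakaoka and Palu: [ext Z X] is
   E(Z,X), [push a d] is the extension a d = E(Z,a)(d), [pull d b] is the
   extension d b = E(b,X)(d), and [real d x y] says that the sequence (x, y)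
   belongs to the equivalence class s(d). *)
Record extricat := ExtriCat {
  ec_base :> addcat;
  ext : ec_base -> ec_base -> zmodType;
  push : forall Z X X' : ec_base, hom X X' -> ext Z X -> ext Z X';
  pull : forall Z Z' X : ec_base, ext Z X -> hom Z' Z -> ext Z' X;
  push1 : forall (Z X : ec_base) (d : ext Z X), push (idm X) d = d;
  pushM : forall (Z X X' X'' : ec_base) (g : hom X' X'') (f : hom X X') (d : ext Z X),
    push (g \oc f) d = push g (push f d);
  pull1 : forall (Z X : ec_base) (d : ext Z X), pull d (idm Z) = d;
  pullM : forall (Z Z' Z'' X : ec_base) (d : ext Z X) (g : hom Z' Z) (f : hom Z'' Z'),
    pull d (g \oc f) = pull (pull d g) f;
  push_pull : forall (Z Z' X X' : ec_base) (a : hom X X') (d : ext Z X) (b : hom Z' Z),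
    push a (pull d b) = pull (push a d) b;
  pushDl : forall (Z X X' : ec_base) (a a' : hom X X') (d : ext Z X),
    push (a + a') d = push a d + push a' d;
  pushDr : forall (Z X X' : ec_base) (a : hom X X') (d d' : ext Z X),
    push a (d + d') = push a d + push a d';
  pullDl : forall (Z Z' X : ec_base) (d d' : ext Z X) (b : hom Z' Z),
    pull (d + d') b = pull d b + pull d' b;
  pullDr : forall (Z Z' X : ec_base) (d : ext Z X) (b b' : hom Z' Z),
    pull d (b + b') = pull d b + pull d b';
  real : forall Z X : ec_base, ext Z X ->
    forall Y : ec_base, hom X Y -> hom Y Z -> Prop;
  real_ex : forall (Z X : ec_base) (d : ext Z X),
    exists (Y : ec_base) (x : hom X Y) (y : hom Y Z), real d x y;
  real_equiv : forall (Z X : ec_base) (d : ext Z X)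
      (Y Y' : ec_base) (x : hom X Y) (y : hom Y Z) (x' : hom X Y') (y' : hom Y' Z),
    real d x y -> (real d x' y' <-> seq_equiv x y x' y');
  real_map : forall (X Y Z : ec_base) (d : ext Z X) (x : hom X Y) (y : hom Y Z)
      (X' Y' Z' : ec_base) (d' : ext Z' X') (x' : hom X' Y') (y' : hom Y' Z')
      (a : hom X X') (c : hom Z Z'),
    real d x y -> real d' x' y' -> push a d = pull d' c ->
    exists b : hom Y Y', b \oc x = x' \oc a /\ y' \oc b = c \oc y;
  real_zero : forall (X Z : ec_base) (B : biprod X Z),
    real (0 : ext Z X) (bin1 B) (bpr2 B);
  real_sum : forall (X Y Z X' Y' Z' : ec_base)
      (d : ext Z X) (x : hom X Y) (y : hom Y Z)
      (d' : ext Z' X') (x' : hom X' Y') (y' : hom Y' Z')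
      (BX : biprod X X') (BY : biprod Y Y') (BZ : biprod Z Z'),
    real d x y -> real d' x' y' ->
    real (push (bin1 BX) (pull d (bpr1 BZ)) + push (bin2 BX) (pull d' (bpr2 BZ)))
      (bimap BX BY x x') (bimap BY BZ y y');
  ET3 : forall (X Y Z : ec_base) (d : ext Z X) (x : hom X Y) (y : hom Y Z)
      (X' Y' Z' : ec_base) (d' : ext Z' X') (x' : hom X' Y') (y' : hom Y' Z')
      (a : hom X X') (b : hom Y Y'),
    real d x y -> real d' x' y' -> b \oc x = x' \oc a ->
    exists c : hom Z Z', c \oc y = y' \oc b /\ push a d = pull d' c;
  ET3op : forall (X Y Z : ec_base) (d : ext Z X) (x : hom X Y) (y : hom Y Z)
      (X' Y' Z' : ec_base) (d' : ext Z' X') (x' : hom X' Y') (y' : hom Y' Z')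
      (b : hom Y Y') (c : hom Z Z'),
    real d x y -> real d' x' y' -> c \oc y = y' \oc b ->
    exists a : hom X X', b \oc x = x' \oc a /\ push a d = pull d' c;
  ET4 : forall (A B D C F : ec_base)
      (d : ext D A) (f : hom A B) (f' : hom B D)
      (d' : ext F B) (g : hom B C) (g' : hom C F),
    real d f f' -> real d' g g' ->
    exists (E : ec_base) (h' : hom C E) (k : hom D E) (e : hom E F) (d'' : ext E A),
      [/\ real d'' (g \oc f) h', h' \oc g = k \oc f' & e \oc h' = g'] /\
      [/\ real (push f' d') k e, pull d'' k = d & push f d'' = pull d' e];
  ET4op : forall (D A B F C : ec_base)
      (d : ext B D) (f' : hom D A) (f : hom A B)
      (d' : ext C F) (g' : hom F B) (g : hom B C),
    real d f' f -> real d' g' g ->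
    exists (E : ec_base) (h' : hom E A) (k : hom D E) (e : hom E F) (d'' : ext C E),
      [/\ real d'' h' (g \oc f), h' \oc k = f' & f \oc h' = g' \oc e] /\
      [/\ real (pull d g') k e, push e d'' = d' & push k d = pull d'' g] }.

Arguments push {e Z X X'} a d.
Arguments pull {e Z Z' X} d b.
Arguments real {e Z X} d {Y} x y.

Section Relative.
Variable C : extricat.

Definition ext_rel : Type := forall Z X : C, ext Z X -> Prop.

(* E_I *)
Definition ext_lower (I : subcat C) : ext_rel := fun Z X d =>
  forall (W : C) (f : hom W Z), I W -> pull d f = 0.

(* E^I *)
Definition ext_upper (I : subcat C) : ext_rel := fun Z X d =>
  forall (W : C) (g : hom X W), I W -> push g d = 0.

Definition tri (K : ext_rel) (X Y Z : C) (d : ext Z X) (x : hom X Y) (y : hom Y Z) :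
    Prop :=
  K Z X d /\ real d x y.

Definition Cone (K : ext_rel) (P Q : C -> Prop) : C -> Prop := fun T =>
  exists (X Y : C) (d : ext T X) (x : hom X Y) (y : hom Y T),
    [/\ P X, Q Y & tri K d x y].

Definition CoCone (K : ext_rel) (P Q : C -> Prop) : C -> Prop := fun T =>
  exists (X Y : C) (d : ext Y T) (x : hom T X) (y : hom X Y),
    [/\ P X, Q Y & tri K d x y].

Definition ext_vanish (K : ext_rel) (P Q : C -> Prop) : Prop :=
  forall (Z X : C) (d : ext Z X), P Z -> Q X -> K Z X d -> d = 0.

Definition ext_closed (K : ext_rel) (P : C -> Prop) : Prop :=
  forall (X Y Z : C) (d : ext Z X) (x : hom X Y) (y : hom Y Z),
    tri K d x y -> P X -> P Z -> P Y.

Definition inflation (X Y : C) (x : hom X Y) : Prop :=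
  exists (Z : C) (y : hom Y Z) (d : ext Z X), real d x y.

Definition deflation (Y Z : C) (y : hom Y Z) : Prop :=
  exists (X : C) (x : hom X Y) (d : ext Z X), real d x y.

Definition left_approx (I : subcat C) (X W : C) (f : hom X W) : Prop :=
  I W /\ forall (W' : C) (g : hom X W'), I W' -> exists k : hom W W', g = k \oc f.

Definition right_approx (I : subcat C) (X W : C) (f : hom W X) : Prop :=
  I W /\ forall (W' : C) (g : hom W' X), I W' -> exists k : hom W' W, g = f \oc k.

Definition strongly_functorially_finite (I Z : subcat C) : Prop :=
  [/\ summand_closed I,
      forall X : C, Z X -> exists (W : C) (f : hom X W), left_approx I f /\ inflation f &
      forall X : C, Z X -> exists (W : C) (f : hom W X), right_approx I f /\ deflation f].

End Relative.

Arguments ext_lower {C} I Z X d.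
Arguments ext_upper {C} I Z X d.

Section Premutation.
Variable C : extricat.
Variables S Z V : subcat C.

Let I : subcat C := subcatI S Z.

(* Z<1> and Z<-1> *)
Definition Zup : C -> Prop := Cone (ext_upper I) Z I.
Definition Zdown : C -> Prop := CoCone (ext_lower I) I Z.

(* U~ and T~ *)
Definition Util : C -> Prop := CoCone (ext_upper I) Z S.
Definition Ttil : C -> Prop := Cone (ext_lower I) V Z.

Record premutation : Prop := Premutation {
  MT1_eq : forall X : C, (S X /\ Z X) <-> (Z X /\ V X);
  MT1_fin : strongly_functorially_finite I Z;
  MT2_SZ : ext_vanish (ext_upper I) S Z;
  MT2_SZdown : ext_vanish (ext_lower I) S Zdown;
  MT2_ZV : ext_vanish (ext_lower I) Z V;
  MT2_ZupV : ext_vanish (ext_upper I) Zup V;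
  MT3_cone : forall X : C, Cone (ext_upper I) Z Z X -> Util X;
  MT3_cocone : forall X : C, CoCone (ext_lower I) Z Z X -> Ttil X;
  MT3_S : ext_closed (ext_upper I) S;
  MT3_Z_upper : ext_closed (ext_upper I) Z;
  MT3_V : ext_closed (ext_lower I) V;
  MT3_Z_lower : ext_closed (ext_lower I) Z }.

(* X -> I^X -> X<1> ~> X *)
Record up_data (X : C) := UpData {
  up_I : C;
  up_sh : C;
  up_i : hom X up_I;
  up_p : hom up_I up_sh;
  up_lam : ext up_sh X;
  up_tri : tri (ext_upper I) up_lam up_i up_p;
  up_approx : left_approx I up_i }.

(* X<-1> -> I_X -> X ~> X<-1> *)
Record down_data (X : C) := DownData {
  dn_I : C;
  dn_sh : C;
  dn_i : hom dn_sh dn_I;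
  dn_p : hom dn_I X;
  dn_lam : ext X dn_sh;
  dn_tri : tri (ext_lower I) dn_lam dn_i dn_p;
  dn_approx : right_approx I dn_p }.

(* U -> sigma U -> S^U ~> U; the equality in [sg_id] is one of pairs
   (target of h, h), since sigma U is only propositionally equal to U *)
Record sigma_data (U : C) := SigmaData {
  sg_ob : C;
  sg_S : C;
  sg_h : hom U sg_ob;
  sg_q : hom sg_ob sg_S;
  sg_ext : ext sg_S U;
  sg_Z : Z sg_ob;
  sg_SS : S sg_S;
  sg_tri : tri (ext_upper I) sg_ext sg_h sg_q;
  sg_id : Z U -> existT (fun Y : C => hom U Y) sg_ob sg_h = existT _ U (idm U) }.

(* V_T -> omega T -> T ~> V_T *)
Record omega_data (T : C) := OmegaData {
  om_ob : C;
  om_V : C;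
  om_j : hom om_V om_ob;
  om_h : hom om_ob T;
  om_ext : ext T om_V;
  om_Z : Z om_ob;
  om_VV : V om_V;
  om_tri : tri (ext_lower I) om_ext om_j om_h;
  om_id : Z T -> existT (fun Y : C => hom Y T) om_ob om_h = existT _ T (idm T) }.

(* X -> Y (+) I^X -> C^a ~> X, together with c^a : C^a -> X<1> *)
Record cone_data (X Y : C) (dX : up_data X) (a : hom X Y) := ConeData {
  cn_bp : biprod Y (up_I dX);
  cn_ob : C;
  cn_b : hom (cn_bp : C) cn_ob;
  cn_ext : ext cn_ob X;
  cn_tri : tri (ext_upper I) cn_ext (bin1 cn_bp \oc a + bin2 cn_bp \oc up_i dX) cn_b;
  cn_c : hom cn_ob (up_sh dX);
  cn_cE : pull (up_lam dX) cn_c = cn_ext }.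

(* C_b -> Y (+) I_Z -> Z ~> C_b, together with c_b : Z<-1> -> C_b *)
Record cocone_data (Y W : C) (dW : down_data W) (b : hom Y W) := CoconeData {
  cc_bp : biprod Y (dn_I dW);
  cc_ob : C;
  cc_a : hom cc_ob (cc_bp : C);
  cc_ext : ext W cc_ob;
  cc_tri : tri (ext_lower I) cc_ext cc_a (b \oc bpr1 cc_bp + dn_p dW \oc bpr2 cc_bp);
  cc_c : hom (dn_sh dW) cc_ob;
  cc_cE : push cc_c (dn_lam dW) = cc_ext }.

Record choices := Choices {
  ch_up : forall X : subob Z, up_data X;
  ch_sigma : forall U : subob Util, sigma_data U;
  ch_cone : forall (X Y : subob Z) (a : hom (X : C) (Y : C)), cone_data (ch_up X) a;
  ch_down : forall X : subob Z, down_data X;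
  ch_omega : forall T : subob Ttil, omega_data T;
  ch_cocone : forall (Y W : subob Z) (b : hom (Y : C) (W : C)),
    cocone_data (ch_down W) b }.

Variables (M : premutation) (ch : choices).

Local Notation i_ X := (up_i (ch_up ch X)).
Local Notation lam_ X := (up_lam (ch_up ch X)).
Local Notation lamd_ X := (dn_lam (ch_down ch X)).

Lemma up_sh_in (X : subob Z) : Util (up_sh (ch_up ch X)).
Proof.
apply: MT3_cone => //; exists (X : C), (up_I (ch_up ch X)), (lam_ X), (i_ X).
exists (up_p (ch_up ch X)); split; [exact: so_in | | exact: up_tri].
exact: (up_approx (ch_up ch X)).1.2.
Qed.

Lemma dn_sh_in (X : subob Z) : Ttil (dn_sh (ch_down ch X)).
Proof.
apply: MT3_cocone => //; exists (dn_I (ch_down ch X)), (X : C), (lamd_ X).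
exists (dn_i (ch_down ch X)), (dn_p (ch_down ch X)).
split; [ | exact: so_in | exact: dn_tri].
exact: (dn_approx (ch_down ch X)).1.2.
Qed.

Lemma cn_ob_in (X Y : subob Z) (a : hom (X : C) (Y : C)) : Util (cn_ob (ch_cone ch a)).
Proof.
apply: MT3_cone => //; exists (X : C), (cn_bp (ch_cone ch a) : C), (cn_ext (ch_cone ch a)).
do 2!eexists; split; [exact: so_in | | exact: cn_tri].
by apply: sub_biprod; [exact: so_in | exact: (up_approx (ch_up ch X)).1.2].
Qed.

Lemma cc_ob_in (Y W : subob Z) (b : hom (Y : C) (W : C)) : Ttil (cc_ob (ch_cocone ch b)).
Proof.
apply: MT3_cocone => //; exists (cc_bp (ch_cocone ch b) : C), (W : C).
exists (cc_ext (ch_cocone ch b)); do 2!eexists; split; [ | exact: so_in | exact: cc_tri].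
by apply: sub_biprod; [exact: so_in | exact: (dn_approx (ch_down ch W)).1.2].
Qed.

Definition QZ : preaddcat := idquot I Z.
Definition QU : preaddcat := idquot I Util.
Definition QT : preaddcat := idquot I Ttil.

(* [up], [down] are <1>, <-1> on objects *)
Definition up (X : QZ) : QU := Subob (up_sh_in X).
Definition sigma (U : QU) : QZ := Subob (sg_Z (ch_sigma ch U)).
Definition down (X : QZ) : QT := Subob (dn_sh_in X).
Definition omega (T : QT) : QZ := Subob (om_Z (ch_omega ch T)).

(* An additive functor is induced by the liftings [L f f'] when every morphism
   has a lifting and the functor sends the class of a morphism to the class of
   any of its liftings. *)
Definition induced (P Q : C -> Prop) (F : idquot I P -> idquot I Q) (Fm : addfunctor F)
    (L : forall X X' : subob P, hom (X : C) (X' : C) ->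
         hom (F X : C) (F X' : C) -> Prop) : Prop :=
  forall (X X' : subob P) (f : hom (X : C) (X' : C)),
    (exists f', L X X' f f') /\
    (forall f', L X X' f f' -> fmap Fm (cls I f) = cls I f').

Definition up_lift (X X' : subob Z) (x : hom (X : C) (X' : C))
    (x1 : hom (up X : C) (up X' : C)) : Prop :=
  pull (lam_ X') x1 = push x (lam_ X).

Definition sigma_lift (U U' : subob Util) (u : hom (U : C) (U' : C))
    (su : hom (sigma U : C) (sigma U' : C)) : Prop :=
  su \oc sg_h (ch_sigma ch U) = sg_h (ch_sigma ch U') \oc u.

Definition down_lift (X X' : subob Z) (x : hom (X : C) (X' : C))
    (x1 : hom (down X : C) (down X' : C)) : Prop :=
  push x1 (lamd_ X) = pull (lamd_ X') x.

Definition omega_lift (T T' : subob Ttil) (t : hom (T : C) (T' : C))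
    (ot : hom (omega T : C) (omega T' : C)) : Prop :=
  om_h (ch_omega ch T') \oc ot = t \oc om_h (ch_omega ch T).

Definition Sig (X : QZ) : QZ := sigma (up X).
Definition Om (X : QZ) : QZ := omega (down X).

Definition adj_spec (Sm : addfunctor Sig) (Omm : addfunctor Om)
    (adj : adjunction Sm Omm) : Prop :=
  forall (X X' : subob Z) (f : hom (X : C) (Om X' : C)) (f' : hom (Sig X : C) (X' : C)),
    adj_r adj (cls I f' : @hom QZ (Sig X) X') = cls I f <->
    push (om_h (ch_omega ch (down X')) \oc f) (lam_ X) =
      - pull (lamd_ X') (f' \oc sg_h (ch_sigma ch (up X))).

Section StandardRight.
Variables (sm : addfunctor sigma) (X Y : subob Z) (a : hom (X : C) (Y : C)).

Definition cn_so : QU := Subob (cn_ob_in a).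

Definition std_f : @hom QZ X Y := cls I a.
Definition std_g : @hom QZ Y (sigma cn_so) :=
  cls I (P := Z) (X := Y) (Y := sigma cn_so)
    (sg_h (ch_sigma ch cn_so) \oc (cn_b (ch_cone ch a) \oc bin1 (cn_bp (ch_cone ch a)))).
Definition std_h : @hom QZ (sigma cn_so) (Sig X) :=
  fmap sm (cls I (X := cn_so) (Y := up X) (cn_c (ch_cone ch a)) : @hom QU cn_so (up X)).

End StandardRight.

Section StandardLeft.
Variables (om : addfunctor omega) (Y W : subob Z) (b : hom (Y : C) (W : C)).

Definition cc_so : QT := Subob (cc_ob_in b).

Definition lstd_h : @hom QZ (Om W) (omega cc_so) :=
  fmap om (cls I (X := down W) (Y := cc_so) (cc_c (ch_cocone ch b)) : @hom QT (down W) cc_so).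
Definition lstd_f : @hom QZ (omega cc_so) Y :=
  cls I (P := Z) (X := omega cc_so) (Y := Y)
    (bpr1 (cc_bp (ch_cocone ch b)) \oc cc_a (ch_cocone ch b) \oc om_h (ch_omega ch cc_so)).
Definition lstd_g : @hom QZ Y W := cls I b.

End StandardLeft.

Definition nabla (sm : addfunctor sigma) (um : addfunctor up) : rseqs Sig :=
  fun X' Y' W' f g h => exists (X Y : subob Z) (a : hom (X : C) (Y : C)),
    rseq_iso (fcomp sm um) (std_f a) (std_g a) (std_h sm a) f g h.

Definition delta (om : addfunctor omega) (dm : addfunctor down) : lseqs Om :=
  fun X' Y' W' h f g => exists (Y W : subob Z) (b : hom (Y : C) (W : C)),
    lseq_iso (fcomp om dm) (lstd_h om b) (lstd_f b) (lstd_g b) h f g.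

End Premutation.

(* Main.v *)
Require Import Defs.
From mathcomp Require Import all_boot all_algebra.
From mathcomp Require Import boolp.

Set Implicit Arguments.
Unset Strict Implicit.
Unset Printing Implicit Defensive.

Import GRing.Theory.
Import Defs.
Local Open Scope ring_scope.

(** The right triangulation is built from the pair (S, Z) out of conflations of
    E^I, and the left one from (V, Z) out of those of E_I.  A premutation triple
    satisfies the same axioms in the opposite extriangulated category with S and
    V exchanged ([premutation_left]), so the left triangulation is the right one
    of the opposite category.

    The right triangulation rests on reflections.  An inflation of E^I from U to
    an object N of Z with cone in S induces a bijection on maps to Z modulo [I]
    ([zequiv_inflation]): maps extend because E^I(S, Z) = 0, and a map S -> Z
    lies in the ideal because E_I(S, Z<-1>) = 0.  Cones of Z in E^I all admit
    such a reflection.  A right triangle is therefore a conflation X -> Y -> U of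
    E^I with X, Y in Z, whose cone U has been reflected into Z ([rep]).  (ET3)
    gives the map on cones asked for by (rTR3) ([rep_morphism]), and a unipotence
    argument shows that the triangle depends only on its first morphism
    ([rep_unique]), hence may be computed from any conflation representing it
    ([rep_change]).  For the rotation one pulls the conflation of X<1> back along
    the connecting morphism U -> X<1> ([rtri_rotate]), and the octahedral axiom
    is (ET4) followed by two reflections ([rtri_octahedron]).  Both use homotopy
    pushouts or pullbacks in extriangulated categories ([homotopy_pushout]),
    which come from comparing two conflations with a common end ([common_end]).

    Maps X -> Omega Y and Sigma X -> Y correspond because, up to sign, both
    describe the elements of E(X<1>, Y<-1>) lying in E_I, or equivalently in E^I
    ([adjunction_ex]).  Compatibility of left and right triangles is a lemma on
    three conflations ([fill]), proved by an object that is a homotopy pushout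
    and a homotopy pullback at the same time; it is self-dual, so both
    compatibility axioms follow from it. *)

(** * Isomorphisms and biproducts in preadditive categories *)

Section Preadditive.
Variable C : preaddcat.
Implicit Types X Y W : C.

Lemma compBl X Y W (g g' : hom Y W) (f : hom X Y) :
  (g - g') \oc f = g \oc f - g' \oc f.
Proof. by rewrite compDl compNm. Qed.

Lemma compBr X Y W (g : hom Y W) (f f' : hom X Y) :
  g \oc (f - f') = g \oc f - g \oc f'.
Proof. by rewrite compDr compmN. Qed.

Lemma is_iso1 X : is_iso (idm X).
Proof. by exists (idm X); rewrite comp1m. Qed.

Lemma is_isoM X Y W (g : hom Y W) (f : hom X Y) :
  is_iso g -> is_iso f -> is_iso (g \oc f).
Proof.
move=> [g' [g'g gg']] [f' [f'f ff']]; exists (f' \oc g'); split.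
  by rewrite -compA (compA g' g) g'g comp1m.
by rewrite -compA (compA f f') ff' comp1m.
Qed.

Lemma is_iso_mono X Y W (f : hom X Y) (g g' : hom W X) :
  is_iso f -> f \oc g = f \oc g' -> g = g'.
Proof.
by move=> [f' [f'f _]] /(congr1 (comp f')); rewrite !compA f'f !comp1m.
Qed.

Lemma is_iso_epi X Y W (f : hom X Y) (g g' : hom Y W) :
  is_iso f -> g \oc f = g' \oc f -> g = g'.
Proof.
move=> [f' [_ ff']] /(congr1 (fun k => k \oc f')).
by rewrite -!compA ff' !compm1.
Qed.

Lemma is_iso_two_sided X Y (f : hom X Y) (g g' : hom Y X) :
  is_iso (g \oc f) -> is_iso (f \oc g') -> is_iso f.
Proof.
move=> [u [u1 _]] [v [_ v2]].
have e1 : (u \oc g) \oc f = idm X by rewrite -compA.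
have e2 : f \oc (g' \oc v) = idm Y by rewrite compA.
exists (u \oc g); split=> //.
by rewrite -[X in f \oc X]compm1 -{1}e2 (compA (u \oc g)) e1 comp1m.
Qed.

Lemma unipotent_iso X (t : hom X X) :
  (t - idm X) \oc (t - idm X) = 0 -> is_iso t.
Proof.
have := subrK (idm X) t; move: (t - idm X) => n <- nn.
exists (idm X - n); split.
  by rewrite compBl !compDr !comp1m !compm1 nn add0r addrAC subrr add0r.
by rewrite compBr !compDl !comp1m !compm1 nn add0r addrAC subrr add0r.
Qed.

Lemma zero_object_src X Y (f : hom X Y) : is_zero X -> f = 0.
Proof. by move=> X0; rewrite -[f]compm1 X0 compm0. Qed.

(** Carried by [X] itself, so that the conflation X = X -> 0 is an instance of
    the realization of a zero extension. *)
Definition biprod_zeror X (O : C) (O0 : is_zero O) : biprod X O.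
Proof.
refine (@Biprod _ X O X (idm X) 0 (idm X) 0 _ _ _ _ _).
- by rewrite comp1m.
- by rewrite comp0m O0.
- by rewrite comp1m.
- by rewrite comp0m.
- by rewrite comp1m comp0m addr0.
Defined.

Definition biprod_swap X Y (B : biprod X Y) : biprod Y X.
Proof.
refine (@Biprod _ Y X B (bin2 B) (bin1 B) (bpr2 B) (bpr1 B) _ _ _ _ _).
- exact: bpr2_in2.
- exact: bpr1_in1.
- exact: bpr2_in1.
- exact: bpr1_in2.
- by rewrite addrC bp_id.
Defined.

Lemma copair_in1 X Y (B : biprod X Y) W (f : hom X W) (g : hom Y W) :
  (f \oc bpr1 B + g \oc bpr2 B) \oc bin1 B = f.
Proof. by rewrite compDl -!compA bpr1_in1 bpr2_in1 compm0 compm1 addr0. Qed.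

Lemma copair_in2 X Y (B : biprod X Y) W (f : hom X W) (g : hom Y W) :
  (f \oc bpr1 B + g \oc bpr2 B) \oc bin2 B = g.
Proof. by rewrite compDl -!compA bpr1_in2 bpr2_in2 compm0 compm1 add0r. Qed.

End Preadditive.

Definition biprod_op (C : preaddcat) (X Y : C) (B : biprod X Y) :
  @biprod (opcat C) X Y :=
  @Biprod (opcat C) X Y B (bpr1 B) (bpr2 B) (bin1 B) (bin2 B)
    (bpr1_in1 B) (bpr2_in2 B) (bpr2_in1 B) (bpr1_in2 B) (bp_id B).

Definition biprod_unop (C : preaddcat) (X Y : C) (B : @biprod (opcat C) X Y) :
  biprod X Y :=
  @Biprod C X Y (bp_ob B) (bpr1 B) (bpr2 B) (bin1 B) (bin2 B)
    (bpr1_in1 B) (bpr2_in2 B) (bpr2_in1 B) (bpr1_in2 B) (bp_id B).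

Lemma is_iso_op (C : preaddcat) (X Y : C) (f : hom X Y) :
  @is_iso (opcat C) Y X f <-> is_iso f.
Proof. by split=> -[g [e1 e2]]; exists g; split. Qed.

Lemma isomorphic_sym (C : preaddcat) (X Y : C) : isomorphic X Y -> isomorphic Y X.
Proof. by move=> [f [g [e1 e2]]]; exists g, f. Qed.

Lemma isomorphic_op (C : preaddcat) (X Y : C) :
  @isomorphic (opcat C) X Y <-> isomorphic X Y.
Proof.
split=> [[f /is_iso_op fi]|/isomorphic_sym[f fi]]; last first.
  by exists f; apply/is_iso_op.
by apply: isomorphic_sym; exists f.
Qed.

Lemma additive_op (C : preaddcat) : additive C -> additive (opcat C).
Proof.
move=> [[O O0] bp]; split; first by exists O.
by move=> X Y; have [B] := bp X Y; exists; exact: biprod_op.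
Qed.

Definition opadd (C : addcat) : addcat := AddCat (additive_op (ac_additive C)).

Definition opsub (C : preaddcat) (P : subcat C) : subcat (opcat C).
Proof.
refine (@Subcat (opcat C) P _ _ _).
- by move=> X Y /isomorphic_op; exact: sub_iso.
- by move=> O O0; exact: (@sub_zero C P O O0).
- by move=> X Y B; exact: (@sub_biprod C P X Y (biprod_unop B)).
Defined.

(** * The opposite extriangulated category *)

Section Opposite.
Variable C : extricat.

Lemma seq_equiv_op (X W Y Y' : C) (x : hom X Y) (y : hom Y W)
    (x' : hom X Y') (y' : hom Y' W) :
  @seq_equiv (opcat C) W X Y Y' y x y' x' <-> seq_equiv x y x' y'.
Proof.
split=> -[b [[b' [/= e1 e2] /= h1 h2]]]; exists b'; split; try (by exists b).
- by rewrite -h2 compA e2 comp1m.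
- by rewrite -h1 -compA e1 compm1.
- by rewrite /= -h2 -compA e2 compm1.
- by rewrite /= -h1 compA e1 comp1m.
Qed.

Definition opE : extricat.
Proof.
refine (@ExtriCat (opadd C) (fun Z X => @ext C X Z)
  (fun Z X X' a d => @pull C X X' Z d a)
  (fun Z Z' X d b => @push C X Z Z' b d)
  _ _ _ _ _ _ _ _ _
  (fun Z X d Y x y => @real C X Z d Y y x)
  _ _ _ _ _ _ _ _ _).
all: try by move=> *; rewrite ?pull1 ?push1 ?pullM ?pushM ?pullDl ?pullDr
  ?pushDl ?pushDr ?push_pull.
- by move=> Z X d /=; have [Y [x [y r]]] := real_ex d; exists Y, y, x.
- move=> Z X d Y Y' x y x' y' r.
  apply: (iff_trans (@real_equiv C X Z d Y Y' y x y' x' r)).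
  by apply: iff_sym; exact: seq_equiv_op.
- move=> X Y Z d x y X' Y' Z' d' x' y' a c r r' e.
  have [b [h1 h2]] := @real_map C _ _ _ _ _ _ _ _ _ _ _ _ c a r' r (esym e).
  by exists b; split.
- by move=> X Z B; exact: (@real_zero C Z X (biprod_swap (biprod_unop B))).
- move=> X Y Z d x y X' Y' Z' d' x' y' BX BY BZ r r' /=.
  have := @real_sum C _ _ _ _ _ _ _ _ _ _ _ _ (biprod_unop BZ) (biprod_unop BY)
    (biprod_unop BX) r r'.
  by rewrite /bimap /= !compA !push_pull.
- move=> X Y Z d x y X' Y' Z' d' x' y' a b r r' e.
  have [c [h1 h2]] := @ET3op C _ _ _ _ _ _ _ _ _ _ _ _ b a r' r (esym e).
  by exists c; split.
- move=> X Y Z d x y X' Y' Z' d' x' y' b c r r' e.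
  have [a [h1 h2]] := @ET3 C _ _ _ _ _ _ _ _ _ _ _ _ c b r' r (esym e).
  by exists a; split.
- move=> A B D X F d f f' d' g g' r r'.
  have [E [h' [k [e [d'' [[q1 q2 q3] [q4 q5 q6]]]]]]] := ET4op r' r.
  exists E, h', e, k, d''; split; split=> //.
- move=> D A B F X d f' f d' g' g r r'.
  have [E [h' [k [e [d'' [[q1 q2 q3] [q4 q5 q6]]]]]]] := ET4 r' r.
  exists E, h', e, k, d''; split; split=> //.
Defined.

End Opposite.
(** * Exactness properties of conflations *)

Section ExtBasics.
Variable C : extricat.

Lemma push0 (Z X X' : C) (a : hom X X') : push a (0 : ext Z X) = 0.
Proof. by apply: (addrI (push a 0)); rewrite -pushDr !addr0. Qed.

Lemma pull0 (Z Z' X : C) (b : hom Z' Z) : pull (0 : ext Z X) b = 0.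
Proof. by apply: (addrI (pull 0 b)); rewrite -pullDl !addr0. Qed.

Lemma push0l (Z X X' : C) (d : ext Z X) : push (0 : hom X X') d = 0.
Proof. by apply: (addrI (push 0 d)); rewrite -pushDl !addr0. Qed.

Lemma pull0r (Z Z' X : C) (d : ext Z X) : pull d (0 : hom Z' Z) = 0.
Proof. by apply: (addrI (pull d 0)); rewrite -pullDr !addr0. Qed.

Lemma pushN (Z X X' : C) (a : hom X X') (d : ext Z X) : push a (- d) = - push a d.
Proof. by apply/eqP; rewrite -addr_eq0 -pushDr addNr push0. Qed.

Lemma pushNl (Z X X' : C) (a : hom X X') (d : ext Z X) : push (- a) d = - push a d.
Proof. by apply/eqP; rewrite -addr_eq0 -pushDl addNr push0l. Qed.

Lemma pullN (Z Z' X : C) (d : ext Z X) (b : hom Z' Z) : pull (- d) b = - pull d b.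
Proof. by apply/eqP; rewrite -addr_eq0 -pullDl addNr pull0. Qed.

Lemma pullNr (Z Z' X : C) (d : ext Z X) (b : hom Z' Z) : pull d (- b) = - pull d b.
Proof. by apply/eqP; rewrite -addr_eq0 -pullDr addNr pull0r. Qed.

Lemma pushBl (Z X X' : C) (a a' : hom X X') (d : ext Z X) :
  push (a - a') d = push a d - push a' d.
Proof. by rewrite pushDl pushNl. Qed.

Lemma pullBr (Z Z' X : C) (d : ext Z X) (b b' : hom Z' Z) :
  pull d (b - b') = pull d b - pull d b'.
Proof. by rewrite pullDr pullNr. Qed.

Lemma zero_ex : exists O : C, is_zero O.
Proof. by have [[O O0] _] := ac_additive C; exists O. Qed.

Lemma biprod_ex (X Y : C) : inhabited (biprod X Y).
Proof. by have [_] := ac_additive C; exact. Qed.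

Lemma real_id (X O : C) : is_zero O -> real (0 : ext O X) (idm X) 0.
Proof. by move=> O0; exact: (real_zero (biprod_zeror X O0)). Qed.

Lemma real_0id (X O : C) : is_zero O -> real (0 : ext X O) 0 (idm X).
Proof.
by move=> O0; exact: (real_zero (biprod_swap (biprod_zeror X O0))).
Qed.

Section Triangle.
Variables (X Y Z : C) (d : ext Z X) (x : hom X Y) (y : hom Y Z).
Hypothesis r : real d x y.

Lemma real_comp0 : y \oc x = 0.
Proof.
have [O O0] := zero_ex.
have [|c [e _]] := ET3 (a := idm X) (b := x) (real_id X O0) r; first by [].
by rewrite -e compm0.
Qed.

Lemma real_push0 : push x d = 0.
Proof.
have [O O0] := zero_ex.
have [|c [_ ->]] := ET3 (a := x) (b := idm Y) r (real_id Y O0); first by [].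
by rewrite pull0.
Qed.

Lemma weak_cokernel (W : C) (f : hom Y W) :
  f \oc x = 0 -> exists g : hom Z W, f = g \oc y.
Proof.
move=> fx; have [O O0] := zero_ex.
have [|c [e _]] := ET3 (a := 0) (b := f) r (real_0id W O0).
  by rewrite fx compm0.
by exists c; rewrite e comp1m.
Qed.

(** A morphism out of [X] killing the extension maps the conflation to a split
    one, and the retraction of the latter gives the extension to [Y]. *)
Lemma push_eq0_factor (W : C) (g : hom X W) :
  push g d = 0 -> exists k : hom Y W, g = k \oc x.
Proof.
move=> gd; have [B] := biprod_ex W Z.
have [|b [e _]] := real_map (a := g) (c := idm Z) r (real_zero B).
  by rewrite gd pull0.
exists (bpr1 B \oc b); rewrite -compA e compA bpr1_in1 comp1m //.
Qed.

(** Realize an extension killed by [x], and map that realization to the given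
    conflation. *)
Lemma push_eq0_pull (W : C) (e : ext W X) :
  push x e = 0 -> exists k : hom W Z, e = pull d k.
Proof.
move=> xe; have [T [u [v re]]] := real_ex e.
have [B] := biprod_ex Y W.
have [|b [e1 _]] := real_map (a := x) (c := idm W) re (real_zero B).
  by rewrite xe pull0.
have [|c [_]] := ET3 (a := idm X) (b := bpr1 B \oc b) re r.
  by rewrite -compA e1 compA bpr1_in1 comp1m compm1.
by rewrite push1; exists c.
Qed.

End Triangle.

End ExtBasics.

Section ExtBasicsDual.
Variables (C : extricat) (X Y Z : C) (d : ext Z X) (x : hom X Y) (y : hom Y Z).
Hypothesis r : real d x y.

Lemma real_pull0 : pull d y = 0.
Proof. exact: (@real_push0 (opE C) Z Y X d y x r). Qed.

Lemma weak_kernel (W : C) (f : hom W Y) :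
  y \oc f = 0 -> exists g : hom W X, f = x \oc g.
Proof. exact: (@weak_cokernel (opE C) Z Y X d y x r W f). Qed.

Lemma pull_eq0_factor (W : C) (g : hom W Z) :
  pull d g = 0 -> exists k : hom W Y, g = y \oc k.
Proof. exact: (@push_eq0_factor (opE C) Z Y X d y x r W g). Qed.

Lemma pull_eq0_push (W : C) (e : ext Z W) :
  pull e y = 0 -> exists k : hom X W, e = push k d.
Proof. exact: (@push_eq0_pull (opE C) Z Y X d y x r W e). Qed.

End ExtBasicsDual.

Section ExtConstructions.
Variable C : extricat.

(** [t - 1] factors both through the inflation and through the deflation, so
    that its square vanishes. *)
Lemma middle_unipotent (X Y Z : C) (d : ext Z X) (x : hom X Y) (y : hom Y Z)
    (t : hom Y Y) :
  real d x y -> t \oc x = x -> y \oc t = y -> is_iso t.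
Proof.
move=> r tx yt; apply: unipotent_iso.
have [|u eu] := weak_cokernel (f := t - idm Y) r.
  by rewrite compBl tx comp1m subrr.
have [|w ew] := weak_kernel (f := t - idm Y) r.
  by rewrite compBr yt compm1 subrr.
by rewrite {1}eu ew -compA (compA y) (real_comp0 r) comp0m compm0.
Qed.

Lemma real_middle_iso (X Y Z Y' : C) (d : ext Z X) (x : hom X Y) (y : hom Y Z)
    (x' : hom X Y') (y' : hom Y' Z) (b : hom Y Y') :
  real d x y -> real d x' y' -> b \oc x = x' -> y' \oc b = y -> is_iso b.
Proof.
move=> r r' bx yb.
have [|b' []] := real_map (a := idm X) (c := idm Z) r' r.
  by rewrite push1 pull1.
rewrite compm1 comp1m => bx' yb'.
apply: (@is_iso_two_sided _ _ _ b b' b').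
  by apply: (middle_unipotent r); rewrite -?compA ?bx // compA yb'.
by apply: (middle_unipotent r'); rewrite -?compA ?bx' // compA yb.
Qed.

Lemma real_iso_right (X Y Z Z' : C) (d : ext Z X) (x : hom X Y) (y : hom Y Z)
    (c : hom Z Z') (c' : hom Z' Z) :
  real d x y -> c' \oc c = idm Z -> c \oc c' = idm Z' ->
  real (pull d c') x (c \oc y).
Proof.
move=> r c'c cc'; have [Y' [x' [y' r']]] := real_ex (pull d c').
have [|b [bx yb]] := real_map (a := idm X) (c := c) r r'.
  by rewrite push1 -pullM c'c pull1.
have [|b' [bx' yb']] := real_map (a := idm X) (c := c') r' r.
  by rewrite push1.
move: bx bx'; rewrite !compm1 => bx bx'.
have bi : is_iso b.
  apply: (@is_iso_two_sided _ _ _ b b' b').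
    apply: (middle_unipotent r); first by rewrite -compA bx.
    by rewrite compA yb' -compA yb compA c'c comp1m.
  apply: (middle_unipotent r'); first by rewrite -compA bx'.
  by rewrite compA yb -compA yb' compA cc' comp1m.
have [b1 [b1b bb1]] := bi.
apply/(real_equiv _ _ r'); exists b1; split.
- by exists b.
- by rewrite -bx compA b1b comp1m.
- by rewrite -yb -compA bb1 compm1.
Qed.

Lemma real_opp (X Y Z : C) (d : ext Z X) (x : hom X Y) (y : hom Y Z) :
  real d x y -> real (- d) x (- y).
Proof.
move=> r; have := @real_iso_right _ _ _ _ d x y (- idm Z) (- idm Z) r.
rewrite !compNm !compmN !comp1m opprK pullNr pull1; exact.
Qed.

Lemma real_equiv_middle (X Y Z Y' : C) (d : ext Z X) (x : hom X Y) (y : hom Y Z)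
    (b : hom Y' Y) (x' : hom X Y') (y' : hom Y' Z) :
  real d x y -> is_iso b -> b \oc x' = x -> y \oc b = y' -> real d x' y'.
Proof.
move=> r [b' [b'b bb']] bx yb; apply/(real_equiv _ _ r); exists b'; split.
- by exists b.
- by rewrite -bx compA b'b comp1m.
- by rewrite -yb -compA bb' compm1.
Qed.

(** Realize the extension with components [d1] and [d2] in E(Z, X1 (+) X2), and
    apply (ET4) to its inflation restricted to either summand. *)
Lemma common_end (X1 X2 Y1 Y2 Z : C) (d1 : ext Z X1) (d2 : ext Z X2)
    (x1 : hom X1 Y1) (y1 : hom Y1 Z) (x2 : hom X2 Y2) (y2 : hom Y2 Z) :
  real d1 x1 y1 -> real d2 x2 y2 ->
  exists (M : C) (m1 : hom X1 M) (m2 : hom X2 M) (e1 : hom M Y1) (e2 : hom M Y2),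
    [/\ real (pull d1 y2) m1 e2, real (pull d2 y1) m2 e1,
        push m1 d1 + push m2 d2 = 0 & e1 \oc m1 = x1 /\ e2 \oc m2 = x2] /\
    y1 \oc e1 = y2 \oc e2.
Proof.
move=> r1 r2; have [B] := biprod_ex X1 X2.
pose mu := push (bin1 B) d1 + push (bin2 B) d2.
have [M [j [z rM]]] := real_ex mu.
have half (U V W : C) (BB : biprod U V) (m : ext Z BB) (jj : hom BB M)
    (v : hom V W) (w : hom W Z) : real m jj z -> real (push (bpr2 BB) m) v w ->
    exists e : hom M W, [/\ real (pull (push (bpr1 BB) m) w) (jj \oc bin1 BB) e,
      e \oc (jj \oc bin2 BB) = v & w \oc e = z].
  move=> rm rv.
  have [E [h [k [e [d'' [[q1 q2 q3] [q4 q5 q6]]]]]]] := ET4 (real_zero BB) rm.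
  have [|b [bk eb]] := real_map (a := idm V) (c := idm Z) rv q4.
    by rewrite push1 pull1.
  rewrite compm1 in bk; rewrite comp1m in eb.
  have [b' [b'b bb']] := real_middle_iso rv q4 bk eb.
  exists (b' \oc h); split.
  - have := real_iso_right q1 bb' b'b.
    have -> : d'' = pull (push (bpr1 BB) m) e.
      by rewrite -push_pull -q6 -pushM bpr1_in1 push1.
    by rewrite -pullM eb; exact.
  - by rewrite -compA (compA h) q2 -compA bpr2_in2 compm1 -bk compA b'b comp1m.
  - by rewrite -eb -compA (compA b) bb' comp1m.
have e2 : push (bpr2 B) mu = d2.
  by rewrite pushDr -!pushM bpr2_in1 bpr2_in2 push0l push1 add0r.
have e1 : push (bpr1 B) mu = d1.
  by rewrite pushDr -!pushM bpr1_in1 bpr1_in2 push0l push1 addr0.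
have [|f2 [g1 g2 g3]] := half _ _ _ B mu j x2 y2 rM; first by rewrite e2.
have [|f1 [g1' g2' g3']] := half _ _ _ (biprod_swap B) mu j x1 y1 rM.
  by rewrite /= e1.
exists M, (j \oc bin1 B), (j \oc bin2 B), f1, f2; split; last by rewrite g3 g3'.
split=> //; first by rewrite -e1.
- by rewrite -e2.
- by rewrite !pushM -pushDr (real_push0 rM).
Qed.

(** The conflations of [d] and of its pushout both end in [Z].  On their
    [common_end] M, the conflation D -> M -> Y splits, because the extension
    [push f d] vanishes when pulled back along [y]; this identifies M with
    D (+) Y. *)
Lemma homotopy_pushout (X Y Z D E : C) (d : ext Z X) (x : hom X Y) (y : hom Y Z)
    (f : hom X D) (u : hom D E) (e : hom E Z) (P : biprod D Y) :
  real d x y -> real (push f d) u e ->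
  exists g : hom Y E, [/\ g \oc x = u \oc f, e \oc g = y &
    real (pull d e) (bin2 P \oc x - bin1 P \oc f) (u \oc bpr1 P + g \oc bpr2 P)].
Proof.
move=> r re.
have [M [m1 [m2 [e1 [e2 [[r1 r2 m12 [e1m1 e2m2]] ee]]]]]] := common_end r re.
have p0 : pull (push f d) y = 0 by rewrite -push_pull (real_pull0 r) push0.
rewrite p0 in r2.
have [|k ek] := push_eq0_factor (g := m1 + m2 \oc f) r.
  by rewrite pushDl pushM.
have e1m2 := real_comp0 r2.
have [s0 es0] : exists s0 : hom Y M, idm Y = e1 \oc s0.
  by apply: (pull_eq0_factor r2); rewrite pull0.
have [w ew] : exists w : hom Z Y, idm Y - e1 \oc k = w \oc y.
  apply: (weak_cokernel r); rewrite compBl comp1m -compA -ek compDr compA e1m2.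
  by rewrite comp0m addr0 e1m1 subrr.
pose s := k + s0 \oc w \oc y.
have e1s : e1 \oc s = idm Y.
  by rewrite compDr -compA compA -es0 comp1m -ew addrC subrK.
have sx : s \oc x = m1 + m2 \oc f.
  by rewrite compDl -!compA (real_comp0 r) !compm0 addr0 ek.
exists (e2 \oc s); split.
- by rewrite -compA sx compDr (real_comp0 r1) add0r compA e2m2.
- by rewrite compA -ee -compA e1s compm1.
have rP := real_zero P.
pose b := m2 \oc bpr1 P + s \oc bpr2 P.
have b1 : b \oc bin1 P = m2.
  by rewrite compDl -!compA bpr1_in1 bpr2_in1 compm0 compm1 addr0.
have b2 : b \oc bin2 P = s.
  by rewrite compDl -!compA bpr1_in2 bpr2_in2 compm0 compm1 add0r.
have bi : is_iso b.
  apply: (real_middle_iso rP r2 b1).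
  by rewrite compDr !compA e1m2 e1s comp0m comp1m add0r.
apply: (real_equiv_middle r1 bi).
  by rewrite compBr !compA b1 b2 sx addrK.
by rewrite compDr !compA e2m2.
Qed.

End ExtConstructions.

(** * Common starts and homotopy pullbacks *)

Section ExtConstructionsDual.
Variable C : extricat.

Lemma common_start (X Y1 Y2 Z1 Z2 : C) (d1 : ext Z1 X) (d2 : ext Z2 X)
    (x1 : hom X Y1) (y1 : hom Y1 Z1) (x2 : hom X Y2) (y2 : hom Y2 Z2) :
  real d1 x1 y1 -> real d2 x2 y2 ->
  exists (M : C) (m1 : hom Y1 M) (m2 : hom Y2 M) (e1 : hom M Z1) (e2 : hom M Z2),
    [/\ real (push x2 d1) m2 e1, real (push x1 d2) m1 e2,
        e1 \oc m1 = y1, e2 \oc m2 = y2 & m1 \oc x1 = m2 \oc x2].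
Proof.
move=> r1 r2.
have [M [e1 [e2 [m1 [m2 [[q1 q2 q3 [q4 q5]] q6]]]]]] :=
  @common_end (opE C) Z1 Z2 Y1 Y2 X d1 d2 y1 x1 y2 x2 r1 r2.
by exists M, m1, m2, e1, e2.
Qed.

Lemma homotopy_pullback (X Y Z D E : C) (d : ext Z X) (x : hom X Y) (y : hom Y Z)
    (f : hom D Z) (u : hom E D) (e : hom X E) (P : biprod D Y) :
  real d x y -> real (pull d f) e u ->
  exists g : hom E Y, [/\ y \oc g = f \oc u, g \oc e = x &
    real (push e d) (bin1 P \oc u + bin2 P \oc g) (y \oc bpr2 P - f \oc bpr1 P)].
Proof.
move=> r re.
exact: (@homotopy_pushout (opE C) Z Y X D E d y x f u e (biprod_op P) r re).
Qed.

End ExtConstructionsDual.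
(** * Quotients by the ideal of morphisms factoring through a subcategory *)

(** A quotient category with the objects of [C] and a full functor [pi] whose
    kernel is the ideal of [I].  It is kept abstract because the quotient of the
    opposite category and the opposite of the quotient are different types:
    both are instances of this structure for the opposite category. *)
Record quot (C : addcat) (I : subcat C) := Quot {
  qh : C -> C -> zmodType;
  qc : forall X Y Z, qh Y Z -> qh X Y -> qh X Z;
  pi : forall X Y : C, hom X Y -> qh X Y;
  pi_surj : forall (X Y : C) (f : qh X Y), exists f0 : hom X Y, f = pi f0;
  piD : forall (X Y : C) (f g : hom X Y), pi (f + g) = pi f + pi g;
  piM : forall (X Y Z : C) (g : hom Y Z) (f : hom X Y),
    pi (g \oc f) = qc (pi g) (pi f);
  pi_eq0 : forall (X Y : C) (f : hom X Y), pi f = 0 <-> factors I f }.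

Arguments qh {C I} q X Y.
Arguments pi {C I} q {X Y} f.

Section QuotCat.
Variables (C : addcat) (I : subcat C) (Q : quot I).

Definition qcat : preaddcat.
Proof.
refine (@PreAddCat (ob C) (qh Q) (fun X => pi Q (idm X)) (@qc C I Q) _ _ _ _ _).
- move=> X Y Z W h g f.
  have [[h0 ->] [g0 ->] [f0 ->]] := And3 (pi_surj h) (pi_surj g) (pi_surj f).
  by rewrite -!piM compA.
- by move=> X Y f; have [f0 ->] := pi_surj f; rewrite -piM comp1m.
- by move=> X Y f; have [f0 ->] := pi_surj f; rewrite -piM compm1.
- move=> X Y Z g g' f.
  have [[h0 ->] [g0 ->] [f0 ->]] := And3 (pi_surj g') (pi_surj g) (pi_surj f).
  by rewrite -!piD -!piM compDl piD.
- move=> X Y Z g f f'.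
  have [[h0 ->] [g0 ->] [f0 ->]] := And3 (pi_surj f') (pi_surj g) (pi_surj f).
  by rewrite -!piD -!piM compDr piD.
Defined.

Definition piq (X Y : C) (f : hom X Y) : @hom qcat X Y := pi Q f.

Lemma piq_surj (X Y : C) (f : @hom qcat X Y) : exists f0 : hom X Y, f = piq f0.
Proof. exact: pi_surj. Qed.

Lemma piqM (X Y Z : C) (g : hom Y Z) (f : hom X Y) :
  piq (g \oc f) = piq g \oc piq f.
Proof. exact: piM. Qed.

Lemma piqD (X Y : C) (g f : hom X Y) : piq (g + f) = piq g + piq f.
Proof. exact: piD. Qed.

Lemma piq1 (X : C) : piq (idm X) = idm (X : qcat).
Proof. by []. Qed.

Lemma piq0 (X Y : C) : piq (0 : hom X Y) = 0.
Proof. by apply: (addrI (piq 0)); rewrite -piqD !addr0. Qed.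

Lemma piqN (X Y : C) (f : hom X Y) : piq (- f) = - piq f.
Proof. by apply/eqP; rewrite -addr_eq0 -piqD addNr piq0. Qed.

Lemma piqB (X Y : C) (g f : hom X Y) : piq (g - f) = piq g - piq f.
Proof. by rewrite piqD piqN. Qed.

Lemma piq_eq0 (X Y : C) (f : hom X Y) : piq f = 0 <-> factors I f.
Proof. exact: pi_eq0. Qed.

Lemma piq_eq (X Y : C) (f g : hom X Y) : piq f = piq g <-> factors I (f - g).
Proof.
split=> [e|/piq_eq0/eqP]; first by apply/piq_eq0; rewrite piqB e subrr.
by rewrite piqB subr_eq0 => /eqP.
Qed.

Lemma piq_factor (X Y W : C) (g : hom W Y) (f : hom X W) : I W -> piq (g \oc f) = 0.
Proof. by move=> IW; apply/piq_eq0; exists W, f, g. Qed.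

Lemma piq_bin1_bpr1 (X Y : C) (B : biprod X Y) : I Y ->
  piq (bin1 B) \oc piq (bpr1 B) = idm (B : qcat).
Proof.
by move=> IY; rewrite -piqM -piq1 -(bp_id B) piqD [X in _ + X]piq_factor ?addr0.
Qed.

Lemma piq_bpr1_bin1 (X Y : C) (B : biprod X Y) :
  piq (bpr1 B) \oc piq (bin1 B) = idm (X : qcat).
Proof. by rewrite -piqM bpr1_in1. Qed.

Lemma piq_bpr1_iso (X Y : C) (B : biprod X Y) : I Y -> is_iso (piq (bpr1 B)).
Proof.
by move=> IY; exists (piq (bin1 B)); rewrite piq_bin1_bpr1 // piq_bpr1_bin1.
Qed.

Lemma piq_bin1_iso (X Y : C) (B : biprod X Y) : I Y -> is_iso (piq (bin1 B)).
Proof.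
by move=> IY; exists (piq (bpr1 B)); rewrite piq_bin1_bpr1 // piq_bpr1_bin1.
Qed.

End QuotCat.

Lemma factors_op (C : addcat) (I : subcat C) (X Y : C) (f : hom X Y) :
  @factors (opadd C) (opsub I) Y X f <-> factors I f.
Proof. by split=> -[W [g [h [IW e]]]]; exists W, h, g. Qed.

Definition opquot (C : addcat) (I : subcat C) (Q : quot I) :
  @quot (opadd C) (opsub I).
Proof.
refine (@Quot (opadd C) (opsub I) (fun X Y => qh Q Y X)
  (fun X Y Z g f => qc f g) (fun X Y f => @pi C I Q Y X f) _ _ _ _).
- by move=> X Y; exact: (@pi_surj C I Q Y X).
- by move=> X Y; exact: (@piD C I Q Y X).
- by move=> X Y Z g f; exact: (@piM C I Q Z Y X f g).
- move=> X Y f; apply: (iff_trans (@pi_eq0 C I Q Y X f)); apply: iff_sym.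
  exact: factors_op.
Defined.

(** * The relative structure E^I *)

Section Upper.
Variables (C : extricat) (I : subcat C).

Lemma upper_push (Z X X' : C) (a : hom X X') (d : ext Z X) :
  ext_upper I _ _ d -> ext_upper I _ _ (push a d).
Proof. by move=> u W g IW; rewrite -pushM u. Qed.

Lemma upper_pull (Z Z' X : C) (d : ext Z X) (b : hom Z' Z) :
  ext_upper I _ _ d -> ext_upper I _ _ (pull d b).
Proof. by move=> u W g IW; rewrite push_pull u // pull0. Qed.

Lemma upperN (Z X : C) (d : ext Z X) : ext_upper I _ _ d -> ext_upper I _ _ (- d).
Proof. by move=> u W g IW; rewrite pushN u // oppr0. Qed.

Lemma upper0 (Z X : C) : ext_upper I _ _ (0 : ext Z X).
Proof. by move=> W g IW; rewrite push0. Qed.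

Lemma upperD (Z X : C) (d d' : ext Z X) :
  ext_upper I _ _ d -> ext_upper I _ _ d' -> ext_upper I _ _ (d + d').
Proof. by move=> u u' W g IW; rewrite pushDr u // u' // addr0. Qed.

Lemma upperP (X Y Z : C) (d : ext Z X) (x : hom X Y) (y : hom Y Z) : real d x y ->
  ext_upper I _ _ d <->
  forall (W : C) (g : hom X W), I W -> exists k : hom Y W, g = k \oc x.
Proof.
move=> r; split=> u W g IW.
  by apply: (push_eq0_factor r); exact: u.
by have [k ->] := u W g IW; rewrite pushM (real_push0 r) push0.
Qed.

Lemma upper_factors (Z X X' : C) (d : ext Z X) (g : hom X X') :
  ext_upper I _ _ d -> factors I g -> push g d = 0.
Proof. by move=> u [W [g1 [h [IW ->]]]]; rewrite pushM u // push0. Qed.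

(** By [upperP], membership in E^I is an extension property of the inflation,
    and such properties pass to composites. *)
Lemma upper_comp (A B D X F E : C) (d : ext D A) (f : hom A B) (f' : hom B D)
    (d' : ext F B) (g : hom B X) (g' : hom X F) (d'' : ext E A) (h : hom X E) :
  tri (ext_upper I) d f f' -> tri (ext_upper I) d' g g' -> real d'' (g \oc f) h ->
  ext_upper I _ _ d''.
Proof.
move=> [u r] [u' r'] r''; apply/(upperP r'') => W k IW.
have [k1 ->] := (upperP r).1 u _ k IW.
by have [k2 ->] := (upperP r').1 u' _ k1 IW; exists k2; rewrite compA.
Qed.

Variable Q : quot I.

(** Extensions in E^I can be pushed along morphisms of [C/[I]]. *)
Lemma upper_piq_push (Z X X' : C) (d : ext Z X) (g g' : hom X X') :
  ext_upper I _ _ d -> piq Q g = piq Q g' -> push g d = push g' d.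
Proof.
move=> u /piq_eq e; apply/eqP; rewrite -subr_eq0 -pushBl.
by rewrite (upper_factors u).
Qed.

(** The error term starts at [X] and factors through an object of [I], hence
    extends along the inflation [x] of E^I; subtracting the extension from [f]
    does not change its class. *)
Lemma upper_rectify (X Y Z W : C) (d : ext Z X) (x : hom X Y) (y : hom Y Z)
    (f : hom Y W) (g : hom X W) :
  tri (ext_upper I) d x y -> piq Q (f \oc x) = piq Q g ->
  exists f' : hom Y W, f' \oc x = g /\ piq Q f' = piq Q f.
Proof.
move=> [u r] /piq_eq [J [a [b [IJ e]]]].
have [k ak] := (upperP r).1 u _ a IJ.
exists (f - b \oc k); split.
  by rewrite compBl -compA -ak -e opprB addrC subrK.
by rewrite piqB piq_factor // subr0.
Qed.

End Upper.
(** * Reflections onto Z modulo the ideal *)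

(** The part of the axioms of a premutation triple, for [I] and the pair
    [(S, Z)], from which the right triangulation is built; the pair [(V, Z)]
    satisfies the same axioms in the opposite category. *)
Record half_premutation (C : extricat) (I S Z : subcat C) : Prop := HalfPremutation {
  hp_sub : forall X : C, I X -> Z X;
  hp_left : forall X : C, Z X ->
    exists (W : C) (f : hom X W), left_approx I f /\ inflation f;
  hp_right : forall X : C, Z X ->
    exists (W : C) (f : hom W X), right_approx I f /\ deflation f;
  hp_vanish : ext_vanish (ext_upper I) S Z;
  hp_vanish_down : ext_vanish (ext_lower I) S (CoCone (ext_lower I) I Z);
  hp_cone : forall X : C, Cone (ext_upper I) Z Z X -> CoCone (ext_upper I) Z S X }.

Section Reflection.
Variables (C : extricat) (I S Z : subcat C) (Q : quot I).
Hypothesis H : half_premutation I S Z.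
Local Notation QC := (qcat Q).
Local Notation "\q f" := (piq Q f) (at level 8, f at level 2, format "\q  f").

(** Morphisms of [C/[I]] seen as isomorphisms by the functors represented by
    the objects of [Z]. *)
Definition zequiv (U U' : C) (j : @hom QC U U') : Prop := forall T : C, Z T ->
  (forall f : @hom QC U T, exists f' : @hom QC U' T, f = f' \oc j) /\
  (forall f1 f2 : @hom QC U' T, f1 \oc j = f2 \oc j -> f1 = f2).

Lemma zequiv_ex (U U' T : C) (j : @hom QC U U') (f : @hom QC U T) :
  zequiv j -> Z T -> exists f' : @hom QC U' T, f = f' \oc j.
Proof. by move=> zj ZT; have [] := zj T ZT. Qed.

Lemma zequiv_inj (U U' T : C) (j : @hom QC U U') (f1 f2 : @hom QC U' T) :
  zequiv j -> Z T -> f1 \oc j = f2 \oc j -> f1 = f2.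
Proof. by move=> zj ZT; have [_] := zj T ZT; exact. Qed.

Lemma zequiv_iso (U U' : C) (j : @hom QC U U') : is_iso j -> zequiv j.
Proof.
move=> ij T ZT; split=> [f|f1 f2]; last exact: is_iso_epi.
by have [j' [j'j jj']] := ij; exists (f \oc j'); rewrite -compA j'j compm1.
Qed.

Lemma zequiv_comp (U U' U'' : C) (j : @hom QC U U') (k : @hom QC U' U'') :
  zequiv j -> zequiv k -> zequiv (k \oc j).
Proof.
move=> zj zk T ZT; split=> [f|f1 f2].
  have [f1 ->] := zequiv_ex f zj ZT; have [f2 ->] := zequiv_ex f1 zk ZT.
  by exists f2; rewrite compA.
by rewrite !compA => /(zequiv_inj zj ZT) /(zequiv_inj zk ZT).
Qed.

Lemma zequiv_cancel (U U' U'' : C) (j : @hom QC U U') (k : @hom QC U' U'') :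
  zequiv j -> zequiv (k \oc j) -> zequiv k.
Proof.
move=> zj zkj T ZT; split=> [f|f1 f2 e].
  have [f' e] := zequiv_ex (f \oc j) zkj ZT; exists f'.
  by apply: (zequiv_inj zj ZT); rewrite e compA.
by apply: (zequiv_inj zkj ZT); rewrite !compA e.
Qed.

Lemma zequiv_is_iso (U U' : C) (j : @hom QC U U') :
  Z U -> Z U' -> zequiv j -> is_iso j.
Proof.
move=> ZU ZU' zj; have [j' e] := zequiv_ex (idm (U : QC)) zj ZU.
exists j'; split=> //; apply: (zequiv_inj zj ZU').
by rewrite -compA -e compm1 comp1m.
Qed.

Lemma inflation_extend (U N S0 T : C) (e : ext S0 U) (j : hom U N) (q : hom N S0)
    (f : hom U T) :
  tri (ext_upper I) e j q -> S S0 -> Z T -> exists f' : hom N T, f = f' \oc j.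
Proof.
move=> [u r] SS ZT; apply: (push_eq0_factor r).
by apply: (hp_vanish H) => //; exact: upper_push.
Qed.

(** Existence comes from the vanishing of E^I(S, Z).  For uniqueness, a morphism
    killed by [j] is one out of [S0] up to the ideal, and this factors through a
    right [I]-approximation of its target by the vanishing of E_I(S, Z<-1>). *)
Lemma zequiv_inflation (U N S0 : C) (e : ext S0 U) (j : hom U N) (q : hom N S0) :
  tri (ext_upper I) e j q -> S S0 -> zequiv (\q j).
Proof.
move=> t SS T ZT; have [u r] := t.
split=> [f|f1 f2 /eqP].
  have [f0 ->] := piq_surj f; have [f' ->] := inflation_extend f0 t SS ZT.
  by exists (\q f'); rewrite piqM.
have [[g1 ->] [g2 ->]] := (piq_surj f1, piq_surj f2).
rewrite -subr_eq0 -compBl -piqB -piqM => /eqP/piq_eq0[J [a [b [IJ eg]]]].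
apply/eqP; rewrite -subr_eq0 -piqB; apply/eqP.
have [a' ea] := inflation_extend a t SS (hp_sub H IJ).
have [|s es] := weak_cokernel (f := g1 - g2 - b \oc a') r.
  by rewrite [LHS]compBl eg ea compA subrr.
have [J' [p [[IJ' pa] [K [m [l rl]]]]]] := hp_right H ZT.
have ll : ext_lower I _ _ l.
  move=> W f IW; have [k ->] := pa _ f IW.
  by rewrite pullM (real_pull0 rl) pull0.
have [|k ek] := pull_eq0_factor (g := s) rl.
  apply: (hp_vanish_down H) => //; last by move=> W f IW; rewrite -pullM ll.
  by exists J', T, l, m, p.
rewrite -(subrK (b \oc a') (g1 - g2)) es ek -compA piqD !piq_factor //.
exact: addr0.
Qed.

End Reflection.

(** * Suspensions and distinguished right triangles *)

Section Presentation.
Variables (C : extricat) (I S Z : subcat C) (Q : quot I).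
Local Notation QC := (qcat Q).
Local Notation "\q f" := (piq Q f) (at level 8, f at level 2, format "\q  f").

(** An equivalence [emb] from [A] onto the full subcategory [Z/[I]] of [C/[I]].
    With [A] a parameter, the same results apply to Z/[I] and to its opposite,
    which is a presentation over the opposite of [C]. *)
Record pres (A : preaddcat) := Pres {
  po : A -> C;
  po_in : forall X, Z (po X);
  po_ess : forall T : C, Z T -> exists X, isomorphic (po X) T;
  emb : forall X Y : A, hom X Y -> @hom QC (po X) (po Y);
  emb_inj : forall (X Y : A) (f g : hom X Y), emb f = emb g -> f = g;
  emb_surj : forall (X Y : A) (f : @hom QC (po X) (po Y)), exists g, f = emb g;
  emb1 : forall X : A, emb (idm X) = idm (po X : QC);
  embM : forall (X Y W : A) (g : hom Y W) (f : hom X Y),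
    emb (g \oc f) = emb g \oc emb f;
  embD : forall (X Y : A) (f g : hom X Y), emb (f + g) = emb f + emb g }.

(** A functor [Sm] on [A] with the universal property of
    sigma o <1>: [eta] is the reflection of X<1> onto [Z/[I]]. *)
Record susp (A : preaddcat) (P : pres A) (Sg : A -> A) (Sm : addfunctor Sg) := Susp {
  su_I : A -> C;
  su_sh : A -> C;
  su_i : forall X, hom (po P X) (su_I X);
  su_p : forall X, hom (su_I X) (su_sh X);
  su_lam : forall X, ext (su_sh X) (po P X);
  su_tri : forall X, tri (ext_upper I) (su_lam X) (su_i X) (su_p X);
  su_in : forall X, I (su_I X);
  su_eta : forall X, @hom QC (su_sh X) (po P (Sg X));
  su_zequiv : forall X, zequiv Z (su_eta X);
  su_nat : forall (X X' : A) (x : hom X X') (x0 : hom (po P X) (po P X'))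
      (x1 : hom (su_sh X) (su_sh X')),
    \q x0 = emb P x -> pull (su_lam X') x1 = push x0 (su_lam X) ->
    emb P (fmap Sm x) \oc su_eta X = su_eta X' \oc \q x1 }.

End Presentation.

Section RightTriangulation.
Variables (C : extricat) (I S Z : subcat C) (Q : quot I).
Hypothesis H : half_premutation I S Z.
Local Notation QC := (qcat Q).
Local Notation "\q f" := (piq Q f) (at level 8, f at level 2, format "\q  f").
Variables (A : preaddcat) (P : pres Z Q A) (Sg : A -> A) (Sm : addfunctor Sg).
Variable R : susp P Sm.
Local Notation o := (po P).
Local Notation emb := (emb P).
Local Notation lam := (su_lam R).
Local Notation eta := (su_eta R).

(** A sequence X -> Y -> W -> Sigma X of [A] read off from a conflation
    X' -> Y' -> U of E^I by identifying X', Y' with X, Y modulo [I] and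
    reflecting U onto W.  Allowing X' and Y' to differ from X and Y makes the
    class of such sequences closed under isomorphisms by construction. *)
Record rep (X Y W : A) (f : hom X Y) (g : hom Y W) (h : hom W (Sg X)) := Rep {
  rp_X : C; rp_Y : C; rp_U : C;
  rp_d : ext rp_U rp_X;
  rp_x : hom rp_X rp_Y;
  rp_y : hom rp_Y rp_U;
  rp_l : hom rp_X (o X);
  rp_r : hom rp_Y (o Y);
  rp_h : @hom QC rp_U (o W);
  rp_c : hom rp_U (su_sh R X);
  rp_tri : tri (ext_upper I) rp_d rp_x rp_y;
  rp_ZX : Z rp_X;
  rp_ZY : Z rp_Y;
  rp_li : is_iso (\q rp_l);
  rp_ri : is_iso (\q rp_r);
  rp_zequiv : zequiv Z rp_h;
  rp_cE : pull (lam X) rp_c = push rp_l rp_d;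
  rp_fE : emb f \oc \q rp_l = \q rp_r \oc \q rp_x;
  rp_gE : emb g \oc \q rp_r = rp_h \oc \q rp_y;
  rp_hE : emb h \oc rp_h = eta X \oc \q rp_c }.

Definition rtri : rseqs Sg := fun X Y W f g h => inhabited (rep f g h).

Lemma embI (X Y : A) : injective (fun f : hom X Y => emb f).
Proof. exact: emb_inj. Qed.

Lemma emb0 (X Y : A) : emb (0 : hom X Y) = 0.
Proof. by apply: (addrI (emb 0)); rewrite -embD !addr0. Qed.

Lemma embN (X Y : A) (f : hom X Y) : emb (- f) = - emb f.
Proof. by apply/eqP; rewrite -addr_eq0 -embD addNr emb0. Qed.

Lemma embB (X Y : A) (f g : hom X Y) : emb (f - g) = emb f - emb g.
Proof. by rewrite embD embN. Qed.

Lemma emb_iso (X Y : A) (f : hom X Y) : is_iso (emb f) <-> is_iso f.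
Proof.
split=> -[g [e1 e2]]; last first.
  by exists (emb g); rewrite -!embM e1 e2 !emb1.
have [g0 eg] := emb_surj g; exists g0; rewrite eg -!embM in e1 e2.
by split; apply: embI; rewrite ?e1 ?e2 emb1.
Qed.

Lemma connecting_ex (X : A) (U : C) (d : ext U (o X)) :
  ext_upper I _ _ d -> exists c : hom U (su_sh R X), pull (lam X) c = d.
Proof.
move=> u; have [v r] := su_tri R X.
have [|k ->] := push_eq0_pull (e := d) r; first by apply: u; exact: su_in.
by exists k.
Qed.

Lemma connecting_uniq (X : A) (U : C) (c c' : hom U (su_sh R X)) :
  pull (lam X) c = pull (lam X) c' -> \q c = \q c'.
Proof.
move=> e; have [v r] := su_tri R X.
have [|k ek] := pull_eq0_factor (g := c - c') r.
  by rewrite pullBr e subrr.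
by apply/eqP; rewrite -subr_eq0 -piqB ek piq_factor //; exact: su_in.
Qed.

Lemma lift_ex (X Y : A) (f : hom X Y) : exists f0 : hom (o X) (o Y), \q f0 = emb f.
Proof. by have [f0 ->] := piq_surj (emb f); exists f0. Qed.

Lemma iso_ex (T : C) : Z T ->
  exists (X : A) (l : hom T (o X)), is_iso (\q l).
Proof.
move=> /(po_ess P)[X [f [g [gf fg]]]]; exists X, g, (\q f).
by rewrite -!piqM gf fg !piq1.
Qed.

Lemma Z_object (X : A) : Z (o X). Proof. exact: po_in. Qed.

(** Lift [x] and [y] to the representing conflations, rectify the square and
    apply (ET3); reflecting the map of cones gives (rTR3).  The maps of
    conflations are kept in the conclusion for [rep_endo_iso]. *)
Lemma rep_morphism (X1 Y1 W1 X2 Y2 W2 : A)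
    (f1 : hom X1 Y1) (g1 : hom Y1 W1) (h1 : hom W1 (Sg X1))
    (f2 : hom X2 Y2) (g2 : hom Y2 W2) (h2 : hom W2 (Sg X2))
    (R1 : rep f1 g1 h1) (R2 : rep f2 g2 h2) (x : hom X1 X2) (y : hom Y1 Y2) :
  y \oc f1 = f2 \oc x ->
  exists (x' : hom (rp_X R1) (rp_X R2)) (y' : hom (rp_Y R1) (rp_Y R2))
         (z' : hom (rp_U R1) (rp_U R2)) (z : hom W1 W2),
    [/\ \q (rp_l R2) \oc \q x' = emb x \oc \q (rp_l R1),
        \q (rp_r R2) \oc \q y' = emb y \oc \q (rp_r R1),
        z' \oc rp_y R1 = rp_y R2 \oc y',
        push x' (rp_d R1) = pull (rp_d R2) z' &
        emb z \oc rp_h R1 = rp_h R2 \oc \q z'] /\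
    z \oc g1 = g2 \oc y /\ h2 \oc z = fmap Sm x \oc h1.
Proof.
move=> e.
have [[l' [_ ll']] [r' [_ rr']]] := (rp_li R2, rp_ri R2).
have [x' ex] := piq_surj (l' \oc (emb x \oc \q (rp_l R1))).
have [y1 ey1] := piq_surj (r' \oc (emb y \oc \q (rp_r R1))).
have lx : \q (rp_l R2) \oc \q x' = emb x \oc \q (rp_l R1).
  by rewrite -ex compA ll' comp1m.
have ry1 : \q (rp_r R2) \oc \q y1 = emb y \oc \q (rp_r R1).
  by rewrite -ey1 compA rr' comp1m.
have [|y' [yx ey]] := upper_rectify (Q := Q) (f := y1) (g := rp_x R2 \oc x') (rp_tri R1).
  apply: (is_iso_mono (rp_ri R2)).
  rewrite !piqM !compA ry1 -rp_fE -!compA lx -rp_fE !compA.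
  by rewrite -!embM e.
have ry : \q (rp_r R2) \oc \q y' = emb y \oc \q (rp_r R1) by rewrite ey.
have [z' [zy xd]] := ET3 (rp_tri R1).2 (rp_tri R2).2 yx.
have [z0 ez0] := zequiv_ex (rp_h R2 \oc \q z') (rp_zequiv R1) (Z_object W2).
have [z ez] := emb_surj z0; rewrite {}ez in ez0.
exists x', y', z', z; split=> //; split; apply: embI; rewrite !embM.
  apply: (is_iso_epi (rp_ri R1)).
  rewrite -!compA -ry rp_gE !compA -ez0 rp_gE -!compA -!piqM; congr (_ \oc _).
  by rewrite zy.
apply: (zequiv_inj (rp_zequiv R1) (Z_object _)).
rewrite -!compA -ez0 rp_hE !compA rp_hE.
have [x0 ex0] := lift_ex x.
have [x1 ex1] := connecting_ex (upper_push x0 (su_tri R X1).1).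
rewrite (su_nat ex0 ex1) -!compA -!piqM; congr (_ \oc _).
apply: connecting_uniq.
rewrite !pullM rp_cE ex1 -!push_pull rp_cE -!pushM -xd -pushM.
by apply: (upper_piq_push (Q := Q) (rp_tri R1).1); rewrite !piqM lx ex0.
Qed.

(** On the cone [U], the endomorphism [t] is unipotent modulo [I]: [t - 1]
    factors through [rp_y] because it kills the extension, and [t - 1] composed
    with [rp_y] is in the ideal. *)
Lemma rep_endo_iso (X Y W : A) (f : hom X Y) (g : hom Y W) (h : hom W (Sg X))
    (R1 : rep f g h) (x' : hom (rp_X R1) (rp_X R1)) (y' : hom (rp_Y R1) (rp_Y R1))
    (t : hom (rp_U R1) (rp_U R1)) (w : hom W W) :
  \q (rp_l R1) \oc \q x' = \q (rp_l R1) ->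
  \q (rp_r R1) \oc \q y' = \q (rp_r R1) ->
  t \oc rp_y R1 = rp_y R1 \oc y' -> push x' (rp_d R1) = pull (rp_d R1) t ->
  emb w \oc rp_h R1 = rp_h R1 \oc \q t -> is_iso w.
Proof.
move=> lx ry ty xd wh.
have x1 : \q x' = \q (idm _).
  by apply: (is_iso_mono (rp_li R1)); rewrite lx compm1.
have y1 : \q y' = \q (idm _).
  by apply: (is_iso_mono (rp_ri R1)); rewrite ry compm1.
have [|m em] := pull_eq0_factor (g := t - idm _) (rp_tri R1).2.
  rewrite pullBr -xd pull1 (upper_piq_push (rp_tri R1).1 x1) push1 subrr //.
have tt : \q (t - idm _) \oc \q (t - idm _) = 0.
  rewrite {2}em piqM compA -piqM compBl ty comp1m piqB piqM y1 -piqM compm1.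
  by rewrite subrr comp0m.
apply: unipotent_iso; apply: embI; apply: (zequiv_inj (rp_zequiv R1) (Z_object _)).
have wh1 : emb (w - idm W) \oc rp_h R1 = rp_h R1 \oc \q (t - idm _).
  by rewrite embB emb1 piqB compBl compBr wh comp1m compm1.
by rewrite embM -compA wh1 compA wh1 -compA tt emb0 comp0m compm0.
Qed.

Lemma rep_unique (X Y W1 W2 : A) (f : hom X Y)
    (g1 : hom Y W1) (h1 : hom W1 (Sg X)) (g2 : hom Y W2) (h2 : hom W2 (Sg X)) :
  rtri f g1 h1 -> rtri f g2 h2 ->
  exists z : hom W1 W2, [/\ is_iso z, z \oc g1 = g2 & h2 \oc z = h1].
Proof.
move=> [R1] [R2].
have e : idm Y \oc f = f \oc idm X by rewrite comp1m compm1.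
have [x1 [y1 [t1 [z1 [[a1 b1 c1 d1 e1] [k1 k2]]]]]] := rep_morphism R1 R2 e.
have [x2 [y2 [t2 [z2 [[a2 b2 c2 d2 e2] _]]]]] := rep_morphism R2 R1 e.
move: a1 b1 a2 b2; rewrite !emb1 !comp1m => a1 b1 a2 b2.
exists z1; split; last by rewrite k2 fmap1 comp1m.
- apply: (@is_iso_two_sided _ _ _ z1 z2 z2).
    apply: (@rep_endo_iso _ _ _ _ _ _ R1 (x2 \oc x1) (y2 \oc y1) (t2 \oc t1)).
    + by rewrite piqM compA a2.
    + by rewrite piqM compA b2.
    + by rewrite -compA c1 !compA c2.
    + by rewrite pushM d1 push_pull d2 pullM.
    + by rewrite embM -compA e1 compA e2 -compA piqM.
  apply: (@rep_endo_iso _ _ _ _ _ _ R2 (x1 \oc x2) (y1 \oc y2) (t1 \oc t2)).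
  + by rewrite piqM compA a1.
  + by rewrite piqM compA b1.
  + by rewrite -compA c2 !compA c1.
  + by rewrite pushM d2 push_pull d1 pullM.
  + by rewrite embM -compA e2 compA e1 -compA piqM.
- by rewrite k1 compm1.
Qed.

(** A cone in E^I of objects of [Z] has an inflation to [Z] with cone in [S], and
    that inflation is a reflection. *)
Lemma rep_complete (X Y : A) (f : hom X Y) (X' Y' U : C) (d : ext U X')
    (x : hom X' Y') (y : hom Y' U) (l : hom X' (o X)) (r : hom Y' (o Y)) :
  tri (ext_upper I) d x y -> Z X' -> Z Y' -> is_iso (\q l) -> is_iso (\q r) ->
  emb f \oc \q l = \q r \oc \q x ->
  exists (W : A) (g : hom Y W) (h : hom W (Sg X)) (hU : @hom QC U (o W))
      (c : hom U (su_sh R X)),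
    [/\ zequiv Z hU, pull (lam X) c = push l d, emb g \oc \q r = hU \oc \q y &
        emb h \oc hU = eta X \oc \q c].
Proof.
move=> t ZX ZY li ri fE.
have [|N [S0 [e [j [q [ZN SS te]]]]]] := hp_cone H (X := U).
  by exists X', Y', d, x, y.
have [W [k ki]] := iso_ex ZN.
have zh : zequiv Z (\q k \oc \q j).
  by apply: zequiv_comp; [exact: (zequiv_inflation Q H te SS) | exact: zequiv_iso].
have [c cE] := connecting_ex (upper_push l t.1).
have [h0 hE] := zequiv_ex (eta X \oc \q c) zh (Z_object _).
have [h eh] := emb_surj h0.
have [r' [r'r rr']] := ri.
have [g eg] := emb_surj (((\q k \oc \q j) \oc \q y) \oc r').
exists W, g, h, (\q k \oc \q j), c; split=> //.
- by rewrite -eg -[LHS]compA r'r compm1.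
- by rewrite -eh -hE.
Qed.

(** Complete the conflation to some right triangle on [f], and compare with the
    given one by [rep_unique].  This allows the axioms to be verified on
    conveniently chosen conflations. *)
Lemma rep_change (X Y W : A) (f : hom X Y) (g : hom Y W) (h : hom W (Sg X))
    (X' Y' U : C) (d : ext U X')
    (x : hom X' Y') (y : hom Y' U) (l : hom X' (o X)) (r : hom Y' (o Y)) :
  rtri f g h ->
  tri (ext_upper I) d x y -> Z X' -> Z Y' -> is_iso (\q l) -> is_iso (\q r) ->
  emb f \oc \q l = \q r \oc \q x ->
  exists (hU : @hom QC U (o W)) (c : hom U (su_sh R X)),
    [/\ zequiv Z hU, pull (lam X) c = push l d, emb g \oc \q r = hU \oc \q y &
        emb h \oc hU = eta X \oc \q c].
Proof.
move=> T t ZX ZY li ri fE.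
have [W2 [g2 [h2 [hU [c [zU cE gE hE]]]]]] := rep_complete t ZX ZY li ri fE.
have T2 : rtri f g2 h2 by exists; exists X' Y' U d x y l r hU c.
have [z [zi zg hz]] := rep_unique T2 T.
exists (emb z \oc hU), c; split=> //.
- by apply: zequiv_comp => //; apply: zequiv_iso; apply/emb_iso.
- by rewrite -zg embM -[LHS]compA gE compA.
- by rewrite compA -embM hz.
Qed.

End RightTriangulation.
Section RightAxioms.
Variables (C : extricat) (I S Z : subcat C) (Q : quot I).
Hypothesis H : half_premutation I S Z.
Local Notation QC := (qcat Q).
Local Notation "\q f" := (piq Q f) (at level 8, f at level 2, format "\q  f").

Lemma up_ex (X : C) : Z X ->
  exists (J L : C) (i : hom X J) (p : hom J L) (m : ext L X),
    [/\ tri (ext_upper I) m i p, left_approx I i & I J].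
Proof.
move=> ZX; have [J [i [[IJ ia] [L [p [m r]]]]]] := hp_left H ZX.
by exists J, L, i, p, m; split=> //; split=> //; apply/(upperP I r).
Qed.

(** The homotopy pushout along [- a]. *)
Lemma cone_ex (X Y J L : C) (a : hom X Y) (m : ext L X) (i : hom X J) (p : hom J L)
    (B : biprod Y J) : tri (ext_upper I) m i p ->
  exists (U : C) (y : hom (B : C) U) (c : hom U L),
    tri (ext_upper I) (pull m c) (bin1 B \oc a + bin2 B \oc i) y.
Proof.
move=> [u r]; have [U [v [c rc]]] := real_ex (push (- a) m).
have [g [_ _ rg]] := homotopy_pushout B r rc.
exists U, (v \oc bpr1 B + g \oc bpr2 B), c; split; first exact: upper_pull.
by move: rg; rewrite compmN opprK addrC.
Qed.

Variables (A : preaddcat) (P : pres Z Q A) (Sg : A -> A) (Sm : addfunctor Sg).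
Variable R : susp P Sm.
Local Notation o := (po P).
Local Notation emb := (emb P).
Local Notation lam := (su_lam R).
Local Notation eta := (su_eta R).
Local Notation ZO := (Z_object P).

Lemma pres_additive : additive A.
Proof.
split.
  have [O O0] := zero_ex C; have [X [f [g [gf fg]]]] := po_ess P (sub_zero Z O0).
  exists X; apply: (embI (P := P)).
  by rewrite emb1 emb0 -piq1 -gf (zero_object_src g O0) comp0m piq0.
move=> X Y; have [B] := biprod_ex (o X) (o Y).
have [W [f [g [gf fg]]]] := po_ess P (@sub_biprod _ Z _ _ B (ZO X) (ZO Y)).
have [i1 e1] := emb_surj (\q (g \oc bin1 B)).
have [i2 e2] := emb_surj (\q (g \oc bin2 B)).
have [p1 e3] := emb_surj (\q (bpr1 B \oc f)).
have [p2 e4] := emb_surj (\q (bpr2 B \oc f)).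
have K (V V' : C) (p : hom (B : C) V) (i : hom V' B) :
    (p \oc f) \oc (g \oc i) = p \oc i by rewrite -compA (compA f) fg comp1m.
exists; refine (@Biprod A X Y W i1 i2 p1 p2 _ _ _ _ _); apply: (embI (P := P)).
- by rewrite embM -e3 -e1 -piqM K bpr1_in1 emb1.
- by rewrite embM -e4 -e2 -piqM K bpr2_in2 emb1.
- by rewrite embM -e3 -e2 -piqM K bpr1_in2 emb0 piq0.
- by rewrite embM -e4 -e1 -piqM K bpr2_in1 emb0 piq0.
- rewrite embD !embM -e1 -e2 -e3 -e4 -!piqM -piqD emb1.
  by rewrite -!(compA g) -compDr !(compA _ _ f) -compDl bp_id comp1m gf piq1.
Qed.

Lemma rtri_iso (X Y W X' Y' W' : A)
    (f : hom X Y) (g : hom Y W) (h : hom W (Sg X))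
    (f' : hom X' Y') (g' : hom Y' W') (h' : hom W' (Sg X')) :
  rtri R f g h -> rseq_iso Sm f g h f' g' h' -> rtri R f' g' h'.
Proof.
move=> [[X0 Y0 U d x y l r hU c t ZX ZY li ri zU cE fE gE hE]].
move=> [a [b [k [[ai bi ki] [ef eg eh]]]]].
have [[a0 ea] [b0 eb]] := (lift_ex P a, lift_ex P b).
have [a1 ea1] := connecting_ex R (upper_push a0 (su_tri R X).1).
have [c' ec'] := connecting_ex R (upper_push (a0 \oc l) t.1).
exists; exists X0 Y0 U d x y (a0 \oc l) (b0 \oc r) (emb k \oc hU) c' => //.
- by rewrite piqM ea; apply: is_isoM => //; apply/emb_iso.
- by rewrite piqM eb; apply: is_isoM => //; apply/emb_iso.
- by apply: zequiv_comp => //; apply: zequiv_iso; apply/emb_iso.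
- by rewrite !piqM ea eb compA -embM -ef embM -[LHS]compA fE compA.
- by rewrite piqM eb compA -embM -eg embM -[LHS]compA gE compA.
- rewrite compA -embM -eh embM -[LHS]compA hE compA (su_nat ea ea1) -[LHS]compA.
  rewrite -piqM; congr (_ \oc _); apply: connecting_uniq.
  by rewrite ec' pullM ea1 -push_pull cE pushM.
Qed.

Lemma rtri_id (X O : A) : is_zero O -> rtri R (idm X) (0 : hom X O) 0.
Proof.
move=> O0; have [N N0] := zero_ex C.
have oO0 : idm (o O : QC) = 0 by rewrite -emb1 O0 emb0.
have qN0 : idm (N : QC) = 0 by rewrite -piq1 N0 piq0.
exists; exists (o X) (o X) N 0 (idm _) 0 (idm _) (idm _) 0 0.
- by split; [exact: upper0 | exact: real_id].
- exact: ZO.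
- exact: ZO.
- exact: is_iso1.
- exact: is_iso1.
- by apply: zequiv_iso; exists 0; rewrite qN0 oO0 !comp0m.
- by rewrite pull0r push0.
- by rewrite emb1 !piq1.
- by rewrite emb0 !comp0m.
- by rewrite piq0 !compm0.
Qed.

(** Adding the approximation of [X] turns [f0] into an inflation of E^I without
    changing its class. *)
Lemma std_conflation (X Y : A) (f : hom X Y) (f0 : hom (o X) (o Y))
    (B : biprod (o Y) (su_I R X)) : \q f0 = emb f ->
  exists (U : C) (d : ext U (o X)) (x : hom (o X) B) (y : hom (B : C) U),
    [/\ tri (ext_upper I) d x y, bpr1 B \oc x = f0, Z B, is_iso (\q (bpr1 B)) &
        emb f \oc \q (idm (o X)) = \q (bpr1 B) \oc \q x].
Proof.
move=> e0; have [U [y [c t]]] := cone_ex f0 B (su_tri R X).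
exists U, (pull (lam X) c), (bin1 B \oc f0 + bin2 B \oc su_i R X), y.
have ep : bpr1 B \oc (bin1 B \oc f0 + bin2 B \oc su_i R X) = f0.
  by rewrite compDr !compA bpr1_in1 bpr1_in2 comp1m comp0m addr0.
split=> //.
- by apply: sub_biprod; [exact: ZO | exact: (hp_sub H (su_in R X))].
- by apply: piq_bpr1_iso; exact: su_in.
- by rewrite -piqM ep compm1 e0.
Qed.

Lemma rtri_ex (X Y : A) (f : hom X Y) :
  exists (W : A) (g : hom Y W) (h : hom W (Sg X)), rtri R f g h.
Proof.
have [f0 e0] := lift_ex P f; have [B] := biprod_ex (o Y) (su_I R X).
have [U [d [x [y [t _ ZB Bi fE]]]]] := std_conflation B e0.
have [W [g [h [hU [c [zU cE gE hE]]]]]] :=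
  rep_complete H R t (ZO X) ZB (@is_iso1 QC (o X)) Bi fE.
exists W, g, h; exists.
exists (o X) (B : C) U d x y (idm _) (bpr1 B) hU c => //; first exact: ZO.
exact: is_iso1.
Qed.

(** Reflections are unique up to isomorphism; the comparison is lifted to [C] in
    order to serve as an identification in [rep]. *)
Lemma reflection_through (U N W : C) (j : @hom QC U N) (h : @hom QC U W) :
  zequiv Z j -> zequiv Z h -> Z N -> Z W ->
  exists r : hom N W, is_iso (\q r) /\ h = \q r \oc j.
Proof.
move=> zj zh ZN ZW; have [r0 e] := zequiv_ex h zj ZW.
have [r er] := piq_surj r0; rewrite {}er in e; exists r; split=> //.
by apply: (zequiv_is_iso ZN ZW); apply: (zequiv_cancel zj); rewrite -e.
Qed.

(** Pulling back the conflation of X<1> along the connecting morphism [c] gives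
    a conflation Y' -> U (+) I^X -> X<1>; composing its inflation with a
    reflecting inflation of [U] gives one with cone reflecting to Sigma X.  The
    extension of X<1> is negated so that the sign in (rTR2) appears. *)
Lemma rtri_rotate (X Y W : A) (f : hom X Y) (g : hom Y W) (h : hom W (Sg X)) :
  rtri R f g h -> rtri R g h (- fmap Sm f).
Proof.
move=> T; have [f0 e0] := lift_ex P f; have [B] := biprod_ex (o Y) (su_I R X).
have [U [d [x [y [t px ZB Bi fE]]]]] := std_conflation B e0.
have [hU [c [zU]]] := rep_change H T t (ZO X) ZB (@is_iso1 QC (o X)) Bi fE.
rewrite push1 => cE gE hE.
have [|N [S0 [e [j [q [ZN SS te]]]]]] := hp_cone H (X := U).
  by exists (o X), (B : C), d, x, y; split=> //; exact: ZO.
have zj := zequiv_inflation Q H te SS.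
have [r [ri hUE]] := reflection_through zj zU ZN (ZO W).
have [BU] := biprod_ex U (su_I R X).
have [BN] := biprod_ex N (su_I R X).
have [O O0] := zero_ex C; have [BS] := biprod_ex S0 O.
have rd : real (pull (- lam X) (- c)) x y by rewrite pullN pullNr opprK cE; exact: t.2.
have [g1 [_ _]] := homotopy_pullback BU (real_opp (su_tri R X).2) rd.
set infl := _ + _ => rs.
set defl := _ - _ in rs.
have rsum := real_sum BU BN BS te.2 (real_id (su_I R X) O0).
set eN := _ + _ in rsum.
have uN : ext_upper I _ _ eN.
  apply: upperD; apply: upper_push; apply: upper_pull; [exact: te.1 | exact: upper0].
have us : ext_upper I _ _ (push x (- lam X)).
  by apply: upper_push; apply: upperN; exact: (su_tri R X).1.
have [E [h' [k [e' [d'' [[q1 q2 q3] [q4 q5 q6]]]]]]] := ET4 rs rsum.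
have ud := upper_comp (conj us rs) (conj uN rsum) q1.
have zk : zequiv Z (\q k).
  apply: (zequiv_inflation Q H (conj (upper_push defl uN) q4)).
  by apply: sub_biprod => //; exact: sub_zero.
have [hE0 ehE] := zequiv_ex (eta X) zk (ZO (Sg X)).
have [cE0 ecE] := connecting_ex R (upper_push (bpr1 B) ud).
have pN : bpr1 BN \oc bimap BU BN j (idm _) = j \oc bpr1 BU.
  by rewrite compDr !compA bpr1_in1 bpr1_in2 !comp0m comp1m addr0.
have Ninj : bimap BU BN j (idm _) \oc bin1 BU = bin1 BN \oc j.
  by rewrite compDl -!compA bpr1_in1 bpr2_in1 !compm0 compm1 addr0.
have dc : defl \oc bin1 BU = c.
  rewrite compBl -!compA bpr1_in1 bpr2_in1 compm0 compm1 sub0r opprK //.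
have pU : bpr1 BU \oc infl = y.
  by rewrite compDr !compA bpr1_in1 bpr1_in2 comp0m comp1m addr0.
have IJ := su_in R X.
have inE := piq_bpr1_bin1 Q BN.
have Npi : is_iso (\q (bpr1 BN)) by exact: piq_bpr1_iso.
have Nii : is_iso (\q (bin1 BN)) by exact: piq_bin1_iso.
exists; exists (B : C) (BN : C) E d'' (bimap BU BN j (idm _) \oc infl) h'
  (bpr1 B) (r \oc bpr1 BN) hE0 cE0 => //.
- by apply: sub_biprod => //; exact: (hp_sub H (su_in R X)).
- by rewrite piqM; exact: is_isoM.
- by apply: (zequiv_cancel zk); rewrite -ehE; exact: su_zequiv.
- rewrite -[RHS]piqM compA -(compA r) pN -!compA pU piqM gE hUE piqM.
  by rewrite compA.
- apply: (is_iso_epi Nii); apply: (zequiv_inj zj (ZO _)).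
  rewrite piqM -2![LHS]compA -(compA (\q r)) (compA \q (bpr1 BN)) inE comp1m -hUE hE.
  rewrite -2![RHS]compA -!piqM -Ninj (compA h') q2 -compA dc piqM.
  by rewrite ehE -[LHS]compA.
- apply: (zequiv_inj zk (ZO _)); rewrite -[LHS]compA -ehE embN compNm.
  have [f1 ef1] := connecting_ex R (upper_push f0 (su_tri R X).1).
  rewrite (su_nat e0 ef1) -compmN -piqN -[RHS]compA -piqM; congr (_ \oc _).
  apply: connecting_uniq.
  by rewrite pullNr ef1 pullM ecE -push_pull q5 -pushM px pushN.
Qed.

End RightAxioms.
Section RightOctahedron.
Variables (C : extricat) (I S Z : subcat C) (Q : quot I).
Hypothesis H : half_premutation I S Z.
Local Notation QC := (qcat Q).
Local Notation "\q f" := (piq Q f) (at level 8, f at level 2, format "\q  f").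
Variables (A : preaddcat) (P : pres Z Q A) (Sg : A -> A) (Sm : addfunctor Sg).
Variable R : susp P Sm.
Local Notation o := (po P).
Local Notation emb := (emb P).
Local Notation lam := (su_lam R).
Local Notation eta := (su_eta R).
Local Notation ZO := (Z_object P).

(** (ET4), applied to composable conflations representing [a] and [a'], gives a
    conflation U1 -> E -> U2 of their cones.  To represent a triangle it has to
    start at, and pass through, objects of [Z]: it is first pushed out along a
    reflecting inflation U1 -> N1 to a conflation N1 -> M -> U2, and then M is
    reflected by an inflation M -> N3, which by (ET4) yields N1 -> N3 -> F.
    All inflations E -> M -> N3 and U2 -> F met on the way have cones in [S], so
    they become invertible on maps to [Z], and the required identities can be
    checked on U1, E and U2. *)
Lemma rtri_octahedron (X Y W D1 D2 D3 : A)
    (a : hom X Y) (b : hom Y D1) (c : hom D1 (Sg X))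
    (a' : hom Y W) (b' : hom W D2) (c' : hom D2 (Sg Y))
    (b'' : hom W D3) (c'' : hom D3 (Sg X)) :
  rtri R a b c -> rtri R a' b' c' -> rtri R (a' \oc a) b'' c'' ->
  exists (s : hom D1 D3) (t : hom D3 D2) (u : hom D2 (Sg D1)),
    rtri R s t u /\
    [/\ s \oc b = b'' \oc a', c'' \oc s = c, t \oc b'' = b',
        u = fmap Sm b \oc c' & c' \oc t = fmap Sm a \oc c''].
Proof.
move=> T1 T2 T3.
have i1 : is_iso (\q (idm (o X))) := @is_iso1 QC (o X).
(* Composable conflations representing [a], [a'] and their composite. *)
have [[a0 ea] [a0' ea']] := (lift_ex P a, lift_ex P a').
have [B1] := biprod_ex (o Y) (su_I R X).
have [U1 [d1 [x1 [y1 [t1 px1 ZB1 Bi1 fE1]]]]] := std_conflation H B1 ea.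
have [h1 [c1 [z1]]] := rep_change H T1 t1 (ZO X) ZB1 i1 Bi1 fE1.
rewrite push1 => cE1 gE1 hE1.
have [J [L [i [p [m [tm _ IJ]]]]]] := up_ex H ZB1.
have [B2] := biprod_ex (o W) J.
have [U2 [y2 [v2]]] := cone_ex (a0' \oc bpr1 B1) B2 tm.
set x2 := bin1 B2 \oc _ + _; set d2 := pull m v2 => t2.
have px2 : bpr1 B2 \oc x2 = a0' \oc bpr1 B1.
  by rewrite compDr !compA bpr1_in1 bpr1_in2 !comp0m comp1m addr0.
have ZB2 : Z B2 by apply: sub_biprod; [exact: ZO | exact: (hp_sub H IJ)].
have Bi2 : is_iso (\q (bpr1 B2)) by exact: piq_bpr1_iso.
have fE2 : emb a' \oc \q (bpr1 B1) = \q (bpr1 B2) \oc \q x2.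
  by rewrite -piqM px2 piqM ea'.
have [h2 [c2 [z2 cE2 gE2 hE2]]] := rep_change H T2 t2 ZB1 ZB2 Bi1 Bi2 fE2.
have [E [y3 [k [e [d3 [[r3 y3x2 ey3] [rk d3k x1d3]]]]]]] := ET4 t1.2 t2.2.
have t3 : tri (ext_upper I) d3 (x2 \oc x1) y3 by split=> //; exact: upper_comp t1 t2 r3.
have fE3 : emb (a' \oc a) \oc \q (idm (o X)) = \q (bpr1 B2) \oc \q (x2 \oc x1).
  by rewrite -piqM compA px2 -compA px1 piqM ea ea' embM [LHS]compm1.
have [h3 [c3 [z3]]] := rep_change H T3 t3 (ZO X) ZB2 i1 Bi2 fE3.
rewrite push1 => cE3 gE3 hE3.
(* The pushout M of U1 -> E along a reflecting inflation of U1. *)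
have [|N1 [S1 [w1 [j1 [q1 [ZN1 SS1 tw1]]]]]] := hp_cone H (X := U1).
  by exists (o X), (B1 : C), d1, x1, y1; split=> //; exact: ZO.
have zj1 := zequiv_inflation Q H tw1 SS1.
have [r1 [ri1 h1E]] := reflection_through zj1 z1 ZN1 (ZO D1).
have [M [m1 [m2 [e1 [e2 [re1 re2 e1m1 e2m2 m1k]]]]]] := common_start rk tw1.2.
have uk : ext_upper I _ _ (push j1 (push y1 d2)).
  by apply: upper_push; apply: upper_push; exact: t2.1.
have zm1 : zequiv Z (\q m1).
  exact: (zequiv_inflation Q H (conj (upper_push k tw1.1) re2)).
(* M is in the domain of the reflection, being also the cone of a morphism
   B1 -> N1 (+) B2 of Z by the homotopy pushout. *)
have [PM] := biprod_ex N1 B2.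
have [|N3 [S3 [w3 [n [qn [ZN3 SS3 tw3]]]]]] := hp_cone H (X := M).
  move: re1; rewrite -pushM => re1'.
  have [g [_ _ rM]] := homotopy_pushout PM t2.2 re1'.
  exists (B1 : C), (PM : C); do 3!eexists; split; [exact: ZB1 | | split; [|exact: rM]].
    exact: sub_biprod.
  by apply: upper_pull; exact: t2.1.
have zn := zequiv_inflation Q H tw3 SS3.
have znm := zequiv_comp zm1 zn.
have [r [ri h3E]] := reflection_through znm z3 ZN3 (ZO D3).
have [F [y' [k' [e' [dF [[rF y'n ey'] [rk' dFk' _]]]]]]] := ET4 re1 tw3.2.
have uF := upper_comp (conj uk re1) tw3 rF.
have zk' : zequiv Z (\q k').
  exact: (zequiv_inflation Q H (conj (upper_push e1 tw3.1) rk')).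
have [hF h2E] := zequiv_ex h2 zk' (ZO D2).
have [[r1' [r1'K r1K]] [r' [r'K rK]]] := (ri1, ri).
have [s es] := emb_surj ((\q r \oc \q (n \oc m2)) \oc r1').
have [t et] := emb_surj ((hF \oc \q y') \oc r').
have sr1 : emb s \oc \q r1 = \q r \oc \q (n \oc m2).
  by rewrite -es -[LHS]compA r1'K compm1.
have tr : emb t \oc \q r = hF \oc \q y' by rewrite -et -[LHS]compA r'K compm1.
have sh1 : emb s \oc h1 = h3 \oc \q k.
  rewrite h1E compA sr1 h3E -!compA -!piqM.
  by rewrite -!compA m1k.
have th3 : emb t \oc h3 = h2 \oc \q e.
  rewrite h3E compA tr h2E -!compA -!piqM; congr (_ \oc _); congr piq.
  by rewrite compA y'n -compA e1m1.
have [cF ecF] := connecting_ex R (upper_push r1 uF).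
exists s, t, (fmap Sm b \oc c'); split.
  exists; exists N1 N3 F dF (n \oc m2) y' r1 r hF cF => //.
    by apply: (zequiv_cancel zk'); rewrite -h2E.
  apply: (zequiv_inj zk' (ZO _)).
  rewrite -[LHS]compA -h2E embM -[LHS]compA hE2 compA.
  have [b0 eb] := lift_ex P b.
  have [b1 eb1] := connecting_ex R (upper_push b0 (su_tri R Y).1).
  rewrite (su_nat eb eb1) -[LHS]compA -[RHS]compA -!piqM; congr (_ \oc _).
  apply: connecting_uniq.
  rewrite !pullM eb1 ecF -!push_pull cE2 dFk' -!pushM.
  by apply: (upper_piq_push (Q := Q) t2.1); rewrite !piqM eb gE1 h1E.
split=> //; apply: (embI (P := P)); rewrite ?embM.
- apply: (is_iso_epi Bi1).
  rewrite -[LHS]compA gE1 compA sh1 -[RHS]compA fE2 compA gE3 -!compA -!piqM.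
  by rewrite y3x2.
- apply: (zequiv_inj z1 (ZO _)).
  rewrite -[LHS]compA sh1 compA hE3 hE1 -[LHS]compA -piqM; congr (_ \oc _).
  by apply: connecting_uniq; rewrite pullM cE3 d3k.
- apply: (is_iso_epi Bi2).
  by rewrite -[LHS]compA gE3 compA th3 gE2 -[LHS]compA -piqM ey3.
- apply: (zequiv_inj z3 (ZO _)).
  rewrite -[LHS]compA th3 compA hE2 -[RHS]compA hE3 [RHS]compA.
  have [a1 ea1] := connecting_ex R (upper_push a0 (su_tri R X).1).
  rewrite (su_nat ea ea1) -[LHS]compA -[RHS]compA -!piqM; congr (_ \oc _).
  apply: connecting_uniq; rewrite !pullM cE2 ea1 -!push_pull cE3.
  by rewrite -x1d3 -pushM px1.
Qed.

Theorem rtri_right_triangulated : right_triangulated Sm (rtri R).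
Proof.
split.
- exact: (pres_additive P).
- by move=> *; apply: rtri_iso; eassumption.
- by move=> X O O0; exact: rtri_id.
- by move=> X Y f; exact: (rtri_ex H).
- by move=> X Y W f g h; exact: (rtri_rotate H).
- move=> X1 Y1 W1 f1 g1 h1 X2 Y2 W2 f2 g2 h2 x y [R1] [R2] e.
  by have [_ [_ [_ [z [_ zE]]]]] := rep_morphism R1 R2 e; exists z.
- move=> X Y W D1 D2 D3 a b c a' b' c' a'' b'' c'' -> T1 T2 T3.
  exact: (rtri_octahedron T1 T2 T3).
Qed.

End RightOctahedron.
(** * The adjunction between suspension and loop functors *)

Section OppositePresentation.
Variables (C : extricat) (I Z : subcat C) (Q : quot I) (A : preaddcat).

Definition oppres (P : pres Z Q A) :
  @pres (opE C) (opsub I) (opsub Z) (opquot Q) (opcat A).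
Proof.
refine (@Pres (opE C) (opsub I) (opsub Z) (opquot Q) (opcat A) (po P)
  (@po_in _ _ _ _ _ P) _ (fun X Y f => @emb _ _ _ _ _ P Y X f) _ _ _ _ _).
- move=> T ZT; have [X XT] := po_ess P ZT.
  by exists X; apply/isomorphic_op.
- by move=> X Y; exact: (@emb_inj _ _ _ _ _ P Y X).
- by move=> X Y; exact: (@emb_surj _ _ _ _ _ P Y X).
- by move=> X; exact: emb1.
- by move=> X Y W g f; exact: (@embM _ _ _ _ _ P W Y X f g).
- by move=> X Y; exact: (@embD _ _ _ _ _ P Y X).
Defined.

End OppositePresentation.

Section Adjoint.
Variables (C : extricat) (I S Z V : subcat C) (Q : quot I).
Local Notation QC := (qcat Q).
Local Notation "\q f" := (piq Q f) (at level 8, f at level 2, format "\q  f").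
Variables (A : preaddcat) (P : pres Z Q A) (Sg Om : A -> A).
Variables (Sm : addfunctor Sg) (Omm : addfunctor Om).
Variables (R : susp P Sm) (L : susp (oppres P) (opfunctor Omm)).
Local Notation o := (po P).
Local Notation emb := (emb P).
Local Notation lam := (su_lam R).
Local Notation eta := (su_eta R).
Local Notation ZO := (Z_object P).

(* The data of L, read in C: X<-1> -> I_X -> X and Omega X -> X<-1>. *)
Local Notation dsh X := (su_sh L X : ob C).
Definition dn_lamL (X : A) : @ext C (o X) (dsh X) := su_lam L X.
Definition dn_etaL (X : A) : @hom QC (o (Om X)) (dsh X) := su_eta L X.
Local Notation ldn := dn_lamL.
Local Notation theta := dn_etaL.

Definition cozequiv (U U' : C) (j : @hom QC U' U) : Prop :=
  @zequiv (opE C) (opsub I) (opsub Z) (opquot Q) U U' j.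

Lemma cozequiv_ex (U U' T : C) (j : @hom QC U' U) (f : @hom QC T U) :
  cozequiv j -> Z T -> exists f' : @hom QC T U', f = j \oc f'.
Proof. exact: (@zequiv_ex (opE C)). Qed.

Lemma cozequiv_inj (U U' T : C) (j : @hom QC U' U) (f1 f2 : @hom QC T U') :
  cozequiv j -> Z T -> j \oc f1 = j \oc f2 -> f1 = f2.
Proof. exact: (@zequiv_inj (opE C)). Qed.

Lemma theta_cozequiv (X : A) : cozequiv (theta X).
Proof. exact: (su_zequiv L X). Qed.

Lemma ldn_real (X : A) : ext_lower I _ _ (ldn X) /\
  exists (J : C) (i : hom (dsh X) J) (p : hom J (o X)), I J /\ real (ldn X) i p.
Proof.
split; first exact: (su_tri L X).1.
exists (su_I L X), (su_p L X), (su_i L X).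
by split; [exact: (su_in L X) | exact: (su_tri L X).2].
Qed.

Lemma theta_nat (X X' : A) (x : hom X X') (x0 : hom (o X) (o X'))
    (x1 : hom (dsh X) (dsh X')) :
  \q x0 = emb x -> push x1 (ldn X) = pull (ldn X') x0 ->
  theta X' \oc emb (fmap Omm x) = \q x1 \oc theta X.
Proof. exact: (@su_nat _ _ _ _ _ _ _ _ L X' X x x0 x1). Qed.

(** The correspondence between X -> Omega Y and Sigma X -> Y, both being
    compared with extensions in E(X<1>, Y<-1>). *)
Definition adjR (X Y : A) (f : hom X (Om Y)) (f' : hom (Sg X) Y) : Prop :=
  exists (k : hom (o X) (dsh Y)) (k' : hom (su_sh R X) (o Y)),
    [/\ \q k = theta Y \oc emb f, \q k' = emb f' \oc eta X &
        push k (lam X) = - pull (ldn Y) k'].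

Lemma lower_piq_pull (X : A) (U : C) (k k' : hom U (o X)) :
  \q k = \q k' -> pull (ldn X) k = pull (ldn X) k'.
Proof.
exact: (@upper_piq_push (opE C) (opsub I) (opquot Q) (dsh X) (o X) U (ldn X)
  k k' (su_tri L X).1).
Qed.

Lemma adjRP (X Y : A) (f : hom X (Om Y)) (f' : hom (Sg X) Y)
    (k : hom (o X) (dsh Y)) (k' : hom (su_sh R X) (o Y)) :
  \q k = theta Y \oc emb f -> \q k' = emb f' \oc eta X ->
  adjR f f' <-> push k (lam X) = - pull (ldn Y) k'.
Proof.
move=> e e'; split=> [[k0 [k0' [e0 e0' E]]]|E]; last by exists k, k'.
rewrite (upper_piq_push (Q := Q) (g' := k0) (su_tri R X).1) ?e ?e0 // E.
by congr (- _); apply: lower_piq_pull; rewrite e' e0'.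
Qed.

(** The class - [pull ldn k'] is in E_I, so it vanishes on I^X and is therefore
    pushed out from the extension of X<1>. *)
Lemma adjR_exr (X Y : A) (f' : hom (Sg X) Y) : exists f, adjR f f'.
Proof.
have [k' ek'] := piq_surj (emb f' \oc eta X).
have [k ek] : exists k : hom (o X) (dsh Y), - pull (ldn Y) k' = push k (lam X).
  apply: (pull_eq0_push (su_tri R X).2).
  by rewrite pullN -pullM (ldn_real Y).1 ?oppr0 //; exact: su_in.
have [f0 ef] := cozequiv_ex (\q k) (theta_cozequiv Y) (ZO X).
have [f e] := emb_surj f0; exists f, k, k'.
by rewrite ef e ek' ek.
Qed.

Lemma adjR_exl (X Y : A) (f : hom X (Om Y)) : exists f', adjR f f'.
Proof.
have [k ek] := piq_surj (theta Y \oc emb f).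
have [ll [J [i [p [IJ rl]]]]] := ldn_real Y.
have [|k' ek'] := push_eq0_pull (e := - push k (lam X)) rl.
  by rewrite pushN -pushM (su_tri R X).1 ?oppr0.
have [f0 ef] := zequiv_ex (\q k') (su_zequiv R X) (ZO Y).
have [f' e] := emb_surj f0; exists f', k, k'.
by rewrite ef e ek -ek' opprK.
Qed.

Lemma adjRB (X Y : A) (f g : hom X (Om Y)) (f' g' : hom (Sg X) Y) :
  adjR f f' -> adjR g g' -> adjR (f - g) (f' - g').
Proof.
move=> [k [k' [e e' E]]] [l [l' [d d' D]]]; exists (k - l), (k' - l').
rewrite !piqB !embB compBl compBr e e' d d' pushBl pullBr E D.
by split=> //; rewrite opprD.
Qed.

Lemma adjR0l (X Y : A) (f' : hom (Sg X) Y) : adjR (0 : hom X (Om Y)) f' -> f' = 0.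
Proof.
move=> [k [k' [e e' E]]]; apply: (embI (P := P)).
apply: (zequiv_inj (su_zequiv R X) (ZO Y)); rewrite emb0 comp0m -e'.
have [ll [J [i [p [IJ rl]]]]] := ldn_real Y.
have [|m ->] := pull_eq0_factor (g := k') rl; last exact: piq_factor.
rewrite -[LHS]opprK -E (upper_piq_push (Q := Q) (g' := 0) (su_tri R X).1).
  by rewrite push0l oppr0.
by rewrite e emb0 compm0 piq0.
Qed.

Lemma adjR0r (X Y : A) (f : hom X (Om Y)) : adjR f (0 : hom (Sg X) Y) -> f = 0.
Proof.
move=> [k [k' [e e' E]]]; apply: (embI (P := P)).
apply: (cozequiv_inj (theta_cozequiv Y) (ZO X)); rewrite emb0 compm0 -e.
have [|m ->] := push_eq0_factor (g := k) (su_tri R X).2.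
  rewrite E (lower_piq_pull (k' := 0)) ?pull0r ?oppr0 //.
  by rewrite e' emb0 comp0m piq0.
by rewrite piq_factor //; exact: su_in.
Qed.

Lemma adjR_eq (X Y : A) (f g : hom X (Om Y)) (f' g' : hom (Sg X) Y) :
  adjR f f' -> adjR g g' -> f = g <-> f' = g'.
Proof.
move=> h h'; have hB := adjRB h h'.
split=> e; apply/eqP; rewrite -subr_eq0; apply/eqP.
  by rewrite e subrr in hB; exact: adjR0l hB.
by rewrite e subrr in hB; exact: adjR0r hB.
Qed.

Lemma adjR_natl (X' X Y : A) (f : hom X (Om Y)) (f' : hom (Sg X) Y) (x : hom X' X) :
  adjR f f' -> adjR (f \oc x) (f' \oc fmap Sm x).
Proof.
move=> [k [k' [e e' E]]]; have [x0 ex] := lift_ex P x.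
have [x1 ex1] := connecting_ex R (upper_push x0 (su_tri R X').1).
exists (k \oc x0), (k' \oc x1); split.
- by rewrite piqM embM e ex -[LHS]compA.
- by rewrite piqM embM e' -[RHS]compA (su_nat ex ex1) -[LHS]compA.
- by rewrite pushM -ex1 push_pull E pullN -pullM.
Qed.

Lemma adjR_natr (X Y Y' : A) (f : hom X (Om Y)) (f' : hom (Sg X) Y) (y : hom Y Y') :
  adjR f f' -> adjR (fmap Omm y \oc f) (y \oc f').
Proof.
move=> [k [k' [e e' E]]]; have [y0 ey] := lift_ex P y.
have [y1 ey1] : exists y1 : hom (dsh Y) (dsh Y'), push y1 (ldn Y) = pull (ldn Y') y0.
  exact: (@connecting_ex _ _ _ _ _ _ _ _ L Y (dsh Y') _
            (@upper_push (opE C) (opsub I) _ _ _ y0 _ (su_tri L Y').1)).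
exists (y1 \oc k), (y0 \oc k'); split.
- by rewrite piqM embM e compA -(theta_nat ey ey1) compA.
- by rewrite piqM embM e' ey compA.
- by rewrite pushM E pushN push_pull ey1 -pullM.
Qed.

Theorem adjunction_ex : exists adj : adjunction Sm Omm,
  forall (X Y : A) (f : hom X (Om Y)) (f' : hom (Sg X) Y),
    adj_r adj f' = f <-> adjR f f'.
Proof.
pose r X Y (f' : hom (Sg X) Y) := sval (cid (adjR_exr f')).
pose l X Y (f : hom X (Om Y)) := sval (cid (adjR_exl f)).
have rP X Y (f' : hom (Sg X) Y) : adjR (r X Y f') f'.
  exact: (svalP (cid (adjR_exr f'))).
have lP X Y (f : hom X (Om Y)) : adjR f (l X Y f).
  exact: (svalP (cid (adjR_exl f))).
unshelve eexists.
  refine (@Adjunction A A Sg Om Sm Omm r l _ _ _ _).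
  - by move=> X Y f; exact: ((adjR_eq (lP _ _ _) (rP _ _ f)).1 erefl).
  - by move=> X Y f; exact: ((adjR_eq (rP _ _ _) (lP _ _ f)).2 erefl).
  - by move=> X' X Y f x; exact: ((adjR_eq (rP _ _ _) (adjR_natl x (rP _ _ f))).2 erefl).
  - by move=> X Y Y' f y; exact: ((adjR_eq (rP _ _ _) (adjR_natr y (rP _ _ f))).2 erefl).
move=> X Y f f' /=; split=> [<-|h]; first exact: rP.
exact: ((adjR_eq (rP _ _ _) h).2 erefl).
Qed.

End Adjoint.

(** * Compatibility of left and right triangles *)

Section Fill.
Variables (C : extricat) (I : subcat C) (Q : quot I).
Local Notation "\q f" := (piq Q f) (at level 8, f at level 2, format "\q  f").

(** A morphism of conflations shifted by one place.  The extension
    [push tau d = - pull m w] is realized by an object [G], which is at once a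
    homotopy pushout of Y' and K, and a homotopy pullback of U and J; the
    former gives G -> T, and the latter turns it into a morphism from
    U (+) J to N. *)
Lemma fill (X' Y' U T N Z' K J L : C)
    (d : ext U X') (x : hom X' Y') (y : hom Y' U)
    (e : ext Z' T) (m : hom T N) (n : hom N Z')
    (mu : ext L K) (i : hom K J) (p : hom J L)
    (tau : hom X' K) (c : hom K T) (l : hom L Z') (w : hom U L) (t : hom Y' T) :
  real d x y -> real e m n -> real mu i p -> I J ->
  push c mu = pull e l -> push tau d = - pull mu w -> t \oc x = c \oc tau ->
  exists u : hom U N, n \oc u = l \oc w /\ \q (u \oc y) = \q (m \oc t).
Proof.
move=> rd re rm IJ ce te tx.
have [G [v [g rG]]] := real_ex (push tau d).
have [B] := biprod_ex K Y'; have [B'] := biprod_ex U J.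
have [b [bx gb rB]] := homotopy_pushout B rd rG.
have [|phi ephi] := weak_cokernel (f := c \oc bpr1 B + t \oc bpr2 B) rB.
  by rewrite compBr !compA copair_in1 copair_in2 tx subrr.
have phiv : phi \oc v = c.
  have := congr1 (fun k => k \oc bin1 B) ephi.
  by rewrite -[in RHS]compA !copair_in1 => ->.
have phib : phi \oc b = t.
  have := congr1 (fun k => k \oc bin2 B) ephi.
  by rewrite -[in RHS]compA !copair_in2 => ->.
have rG' : real (pull mu (- w)) v g by rewrite pullNr -te.
have [g' [_ _ rB']] := homotopy_pullback B' rm rG'.
have [|k [kE nk]] := real_map (a := phi) (c := l) rB' re.
  by rewrite -pushM phiv.
exists (k \oc bin1 B'); split.
  rewrite compA nk -compA compBl -!compA bpr1_in1 bpr2_in1 compm0 compm1.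
  by rewrite sub0r opprK.
have -> : m \oc t = (k \oc bin1 B') \oc y + (k \oc bin2 B') \oc (g' \oc b).
  by rewrite -phib -gb compA -kE compDr compDl !compA.
by rewrite [RHS]piqD [X in _ + X]piq_factor ?addr0.
Qed.

End Fill.
Section Pretriangulation.
Variables (C : extricat) (I S Z V : subcat C) (Q : quot I).
Hypothesis HR : half_premutation I S Z.
Hypothesis HL : @half_premutation (opE C) (opsub I) (opsub V) (opsub Z).
Local Notation QC := (qcat Q).
Local Notation "\q f" := (piq Q f) (at level 8, f at level 2, format "\q  f").
Variables (A : preaddcat) (P : pres Z Q A) (Sg Om : A -> A).
Variables (Sm : addfunctor Sg) (Omm : addfunctor Om).
Variables (R : susp P Sm) (L : susp (oppres P) (opfunctor Omm)).
Local Notation o := (po P).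
Local Notation emb := (emb P).
Local Notation lam := (su_lam R).
Local Notation eta := (su_eta R).
Local Notation ldn := (dn_lamL L).
Local Notation theta := (dn_etaL L).
Local Notation ZO := (Z_object P).

Definition ltri : lseqs Om := fun X Y W h f g => @rtri _ _ _ _ _ _ _ _ L W Y X g f h.

(** The definition of [ltri], brought back from the opposite category. *)
Lemma ltri_data (X Y W : A) (h : hom (Om W) X) (f : hom X Y) (g : hom Y W) :
  ltri h f g ->
  exists (T N W' : C) (e : ext W' T) (m : hom T N) (n : hom N W')
      (l : hom (o W) W') (r : hom (o Y) N) (hT : @hom QC (o X) T)
      (c : hom (su_sh L W : C) T),
    [/\ ext_lower I _ _ e, real e m n, is_iso (\q l), is_iso (\q r) &
        @cozequiv _ _ Z Q _ _ hT] /\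
    [/\ push c (ldn W) = pull e l, \q l \oc emb g = \q n \oc \q r,
        \q r \oc emb f = \q m \oc hT & hT \oc emb h = \q c \oc theta W].
Proof.
move=> [[W' N T e n m l r hT c [u re] _ _ li ri zT cE gE fE hE]].
exists T, N, W', e, m, n, l, r, hT, c; split; split=> //; exact/is_iso_op.
Qed.

(** Dual of [upper_rectify]. *)
Lemma lower_rectify (X Y W T : C) (d : ext W X) (x : hom X Y) (y : hom Y W)
    (f : hom T Y) (g : hom T W) :
  ext_lower I _ _ d -> real d x y -> \q (y \oc f) = \q g ->
  exists f' : hom T Y, y \oc f' = g /\ \q f' = \q f.
Proof.
move=> u r; exact: (@upper_rectify (opE C) _ (opquot Q) W Y X T d y x f g (conj u r)).
Qed.

(** Dual of [fill]. *)
Lemma fill_dual (X' Y' U T N W' K J M : C)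
    (d : ext U X') (x : hom X' Y') (y : hom Y' U)
    (e : ext W' T) (m : hom T N) (n : hom N W')
    (mu : ext M K) (i : hom K J) (p : hom J M)
    (tau : hom M W') (c : hom U M) (l : hom X' K) (w : hom K T) (t : hom U N) :
  real d x y -> real e m n -> real mu i p -> I J ->
  pull mu c = push l d -> pull e tau = - push w mu -> n \oc t = tau \oc c ->
  exists u : hom Y' T, u \oc x = w \oc l /\ \q (m \oc u) = \q (t \oc y).
Proof.
move=> rd re rm IJ mc et nt.
exact: (@fill (opE C) (opsub I) (opquot Q) W' N T U Y' X' M J K
  e n m d y x mu p i tau c l w t re rd rm IJ mc et nt).
Qed.

Variable adj : adjunction Sm Omm.
Hypothesis adjP : forall (X Y : A) (f : hom X (Om Y)) (f' : hom (Sg X) Y),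
  adj_r adj f' = f <-> adjR R L f f'.

(** This is [fill] for the conflations representing the two triangles and the
    conflation of Z2<-1>; that [s] and [s'] correspond under the adjunction is
    exactly the compatibility of extensions it requires. *)
Lemma rtri_ltri_fill_right (X1 Y1 Z1 : A) (f1 : hom X1 Y1) (g1 : hom Y1 Z1)
    (h1 : hom Z1 (Sg X1)) (X2 Y2 Z2 : A) (h2 : hom (Om Z2) X2) (f2 : hom X2 Y2)
    (g2 : hom Y2 Z2) (s : hom X1 (Om Z2)) (s' : hom (Sg X1) Z2) (t : hom Y1 X2) :
  rtri R f1 g1 h1 -> ltri h2 f2 g2 -> adjR R L s s' -> t \oc f1 = h2 \oc s ->
  exists u : hom Z1 Y2, u \oc g1 = f2 \oc t /\ g2 \oc u = s' \oc h1.
Proof.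
move=> [[X' Y' U d x y l1 r1 hU c tr ZX ZY li1 ri1 zU cE fE gE hE]].
move=> /ltri_data[T [N [W' [e [m [n [l2 [r2 [hT [c2]]]]]]]]]].
move=> [[ue re li2 ri2 zT] [c2E g2E f2E h2E]] [k [k' [ks ks' kk]]] ts.
have [t0 et0] := piq_surj (hT \oc (emb t \oc \q r1)).
have [|t1 [t1x et1]] := upper_rectify (Q := Q) (f := t0) (g := c2 \oc (k \oc l1)) tr.
  rewrite !piqM ks -et0 !compA -h2E -!compA -fE !compA.
  by rewrite -(compA hT) -embM ts embM !compA.
have [_ [J [i [p [IJ rl]]]]] := ldn_real L Z2.
have td : push (k \oc l1) d = - pull (ldn Z2) (k' \oc c).
  by rewrite pushM -cE push_pull kk pullN pullM.
have [u [nu uy]] := fill Q tr.2 re rl IJ c2E td t1x.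
have [r2' [r2'K r2K]] := ri2.
have [u1 eu1] := zequiv_ex (r2' \oc \q u) zU (ZO Y2).
have [v ev] := emb_surj u1; rewrite {}ev in eu1.
have vU : \q r2 \oc (emb v \oc hU) = \q u by rewrite -eu1 compA r2K comp1m.
exists v; split; apply: (embI (P := P)); rewrite !embM.
  apply: (is_iso_epi ri1); apply: (is_iso_mono ri2).
  rewrite -(compA (emb v)) gE !compA -(compA (\q r2)) vU -piqM uy f2E -!compA.
  by rewrite piqM et1 -et0.
apply: (zequiv_inj zU (ZO _)); apply: (is_iso_mono li2).
rewrite !compA g2E -!compA vU hE (compA (emb s')) -ks' -!piqM nu.
by rewrite !piqM.
Qed.

Lemma rtri_ltri_fill_left (X1 Y1 Z1 : A) (f1 : hom X1 Y1) (g1 : hom Y1 Z1)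
    (h1 : hom Z1 (Sg X1)) (X2 Y2 Z2 : A) (h2 : hom (Om Z2) X2) (f2 : hom X2 Y2)
    (g2 : hom Y2 Z2) (s : hom X1 (Om Z2)) (s' : hom (Sg X1) Z2) (t : hom Z1 Y2) :
  rtri R f1 g1 h1 -> ltri h2 f2 g2 -> adjR R L s s' -> s' \oc h1 = g2 \oc t ->
  exists u : hom Y1 X2, u \oc f1 = h2 \oc s /\ f2 \oc u = t \oc g1.
Proof.
move=> [[X' Y' U d x y l1 r1 hU c tr ZX ZY li1 ri1 zU cE fE gE hE]].
move=> /ltri_data[T [N [W' [e [m [n [l2 [r2 [hT [c2]]]]]]]]]].
move=> [[ue re li2 ri2 zT] [c2E g2E f2E h2E]] [k [k' [ks ks' kk]]] ts.
have [t0 et0] := piq_surj (\q r2 \oc (emb t \oc hU)).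
have [|t1 [nt1 et1]] := lower_rectify (f := t0) (g := (l2 \oc k') \oc c) ue re.
  rewrite !piqM ks' -et0 !compA -g2E -!compA -hE (compA (emb g2)) -embM -ts embM.
  by rewrite !compA.
have et : pull e (l2 \oc k') = - push (c2 \oc k) (lam X1).
  by rewrite pullM -c2E -push_pull pushM kk pushN opprK.
have [u [ux mu]] := fill_dual tr.2 re (su_tri R X1).2 (su_in R X1) cE et nt1.
have [r1' [r1'K r1K]] := ri1.
have [u1 eu1] := cozequiv_ex (\q u \oc r1') zT (ZO Y1).
have [v ev] := emb_surj u1; rewrite {}ev in eu1.
have vT : (hT \oc emb v) \oc \q r1 = \q u by rewrite -eu1 -compA r1'K compm1.
exists v; split; apply: (embI (P := P)); rewrite !embM.
  apply: (cozequiv_inj zT (ZO _)); apply: (is_iso_epi li1).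
  rewrite compA -[LHS]compA fE compA vT -piqM ux compA h2E -!compA.
  by rewrite !piqM ks -!compA.
apply: (is_iso_epi ri1); apply: (is_iso_mono ri2).
rewrite !compA f2E -!compA (compA hT) vT -piqM mu piqM et1 -et0 gE.
by rewrite -!compA.
Qed.

Theorem rtri_ltri_pretriangulated : pretriangulated adj (rtri R) ltri.
Proof.
split.
- exact: (rtri_right_triangulated HR R).
- exact: (rtri_right_triangulated HL L).
- move=> X1 Y1 Z1 f1 g1 h1 X2 Y2 Z2 h2 f2 g2 T1 T2 s t.
  apply: rtri_ltri_fill_right T1 T2 _; apply/adjP.
  by rewrite adj_natl adj_lK comp1m.
- move=> X1 Y1 Z1 f1 g1 h1 X2 Y2 Z2 h2 f2 g2 T1 T2 t u e.
  have [|s] := rtri_ltri_fill_left (s := fmap Omm u \oc adj_unit adj X1) T1 T2 _ e.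
    by apply/adjP; rewrite -adj_natr compm1.
  by rewrite compA; exists s.
Qed.

End Pretriangulation.
(** * Premutation triples *)

Section FromPremutation.
Variables (C : extricat) (S Z V : subcat C).
Hypothesis M : premutation S Z V.
Local Notation I := (subcatI S Z).

Lemma premutation_right : half_premutation I S Z.
Proof.
have [_ fl fr] := MT1_fin M.
split=> //; [by move=> X [] | exact: MT2_SZ M | exact: MT2_SZdown M |].
exact: MT3_cone M.
Qed.

Lemma premutation_left : @half_premutation (opE C) (opsub I) (opsub V) (opsub Z).
Proof.
have [_ fl fr] := MT1_fin M; split.
- by move=> X [].
- exact: fr.
- exact: fl.
- by move=> X Y d VX ZY; exact: (@MT2_ZV _ _ _ _ M Y X d ZY VX).
- move=> X T d VX [J [Y [e [x [y [IJ ZY te]]]]]].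
  apply: (@MT2_ZupV _ _ _ _ M T X d _ VX).
  by exists Y, J, e, y, x.
- move=> X [X' [Y [d [x [y [ZX ZY t]]]]]].
  have [|T [N [e [j [h [VT ZN te]]]]]] := @MT3_cocone _ _ _ _ M X.
    by exists Y, X', d, y, x.
  by exists N, T, e, h, j.
Qed.

Lemma inhabited_pi (T : Type) (F : T -> Type) :
  (forall x, inhabited (F x)) -> inhabited (forall x, F x).
Proof.
move=> h; exists => x; suff : exists _ : F x, True by move=> /cid[].
by have [y] := h x; exists y.
Qed.

Lemma choices_inhabited : inhabited (choices S Z V).
Proof.
have [O O0] := zero_ex C.
have [u] : inhabited (forall X : subob Z, up_data S Z X).
  apply: inhabited_pi => X.
  have [J [L [i [p [m [t a _]]]]]] := up_ex premutation_right (so_in X).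
  by exists; exact: (UpData t a).
have [d] : inhabited (forall X : subob Z, down_data S Z X).
  apply: inhabited_pi => X.
  have [J [L [p [i [m [t a _]]]]]] := up_ex premutation_left (so_in X).
  by exists; exact: (@DownData C S Z X J L i p m t a).
have [s] : inhabited (forall U : subob (Util S Z), sigma_data S Z U).
  apply: inhabited_pi => -[U [N [S0 [e [h [q [ZN SS t]]]]]]] /=.
  have [ZU|nZU] := pselect (Z U); exists.
    apply: (@SigmaData C S Z U U O (idm U) 0 0) => //; first exact: sub_zero.
    by split; [exact: upper0 | exact: real_id].
  exact: (@SigmaData C S Z U N S0 h q e ZN SS t).
have [w] : inhabited (forall T : subob (Ttil S Z V), omega_data S Z V T).
  apply: inhabited_pi => -[T [V0 [N [e [j [h [VV ZN t]]]]]]] /=.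
  have [ZT|nZT] := pselect (Z T); exists.
    apply: (@OmegaData C S Z V T T O 0 (idm T) 0) => //; first exact: sub_zero.
    split; last exact: real_0id.
    exact: (@upper0 (opE C) (opsub I)).
  exact: (@OmegaData C S Z V T N V0 j h e ZN VV t).
have [c] : inhabited (forall k : {XY : subob Z * subob Z & hom (XY.1 : C) (XY.2 : C)},
    cone_data (u (tag k).1) (tagged k)).
  apply: inhabited_pi => -[[X Y] a] /=; have [B] := biprod_ex Y (up_I (u X)).
  have [U [y [c t]]] := cone_ex a B (up_tri (u X)).
  by exists; exact: (ConeData t erefl).
have [c'] : inhabited (forall k : {YW : subob Z * subob Z & hom (YW.1 : C) (YW.2 : C)},
    cocone_data (d (tag k).2) (tagged k)).
  apply: inhabited_pi => -[[Y W] b] /=; have [B] := biprod_ex Y (dn_I (d W)).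
  have [U [y [c' t]]] := @cone_ex (opE C) (opsub I) W Y _ _ b _ _ _
    (biprod_op B) (dn_tri (d W)).
  by exists; exact: (@CoconeData C S Z Y W (d W) b B U y _ t c' erefl).
exists; apply: (@Choices C S Z V u s _ d w).
  by move=> X Y a; exact: (c (existT _ (X, Y) a)).
by move=> Y W b; exact: (c' (existT _ (Y, W) b)).
Qed.

End FromPremutation.

(** * The induced functors *)

Section InducedFunctor.
Variables (C : extricat) (S Z : subcat C).
Local Notation I := (subcatI S Z).
Variables (P P' : C -> Prop) (F : idquot I P -> idquot I P').
Variable L : forall X X' : subob P, hom (X : C) (X' : C) ->
  hom (F X : C) (F X' : C) -> Prop.
Hypothesis L_ex : forall X X' f, exists f', @L X X' f f'.
Hypothesis L_factors : forall X X' f f', @L X X' f f' -> factors I f -> factors I f'.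
Hypothesis LB : forall X X' f f' g g',
  @L X X' f f' -> @L X X' g g' -> L (f - g) (f' - g').
Hypothesis L1 : forall X : subob P, @L X X (idm (X : C)) (idm (F X : C)).
Hypothesis LM : forall (X Y W : subob P)
    (g : hom (Y : C) (W : C)) (f : hom (X : C) (Y : C)) g' f',
  L g g' -> L f f' -> L (g \oc f) (g' \oc f').

(** A class is sent to the class of a lift of any representative; [LB] and
    [L_factors] make the result independent of the choices. *)
Lemma induced_ex : exists Fm : addfunctor F, induced Fm L.
Proof.
have uniq (X X' : subob P) (f g : hom (X : C) (X' : C)) f' g' :
    L f f' -> L g g' -> qpi I f = qpi I g -> qpi I f' = qpi I g'.
  by move=> lf lg /qpi_eq e; apply/qpi_eq; exact: L_factors (LB lf lg) e.
have LD (X X' : subob P) (f g : hom (X : C) (X' : C)) f' g' :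
    L f f' -> L g g' -> L (f + g) (f' + g').
  move=> lf lg; have l0 := LB lf lf; rewrite !subrr in l0.
  by have := LB lf (LB l0 lg); rewrite !sub0r !opprK.
pose m (X X' : idquot I P) (q : hom X X') : @hom (idquot I P') (F X) (F X') :=
  qpi I (sval (cid (L_ex (qrepr q)))).
have mE (X X' : subob P) (f : hom (X : C) (X' : C)) f' :
    L f f' -> m X X' (cls I f) = cls I f'.
  by move=> l; apply: (uniq _ _ _ _ _ _ (svalP (cid (L_ex _))) l); rewrite qreprK.
have mr (X X' : idquot I P) (q : hom X X') : exists f f', L f f' /\ q = cls I f.
  have [f' l] := L_ex (qrepr q); exists (qrepr q), f'; split=> //.
  by rewrite /cls qreprK.
unshelve eexists.
  refine (@AddFunctor _ _ F m _ _ _).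
  - by move=> X; rewrite (mE _ _ _ _ (L1 X)).
  - move=> X Y W g f; have [g0 [g' [lg ->]]] := mr _ _ g.
    have [f0 [f' [lf ->]]] := mr _ _ f.
    rewrite (mE _ _ _ _ lg) (mE _ _ _ _ lf) /= !qcompE.
    exact: (mE _ _ _ _ (LM lg lf)).
  - move=> X Y g f; have [g0 [g' [lg ->]]] := mr _ _ g.
    have [f0 [f' [lf ->]]] := mr _ _ f.
    rewrite (mE _ _ _ _ lg) (mE _ _ _ _ lf) /cls -!qpiD.
    exact: (mE _ _ _ _ (LD _ _ _ _ _ _ lg lf)).
by move=> X X' f; split; [exact: L_ex | move=> f' /mE].
Qed.

End InducedFunctor.

Section LiftLemmas.
Variables (C : extricat) (I : subcat C).

Lemma shift_lift_ex (X X' J J' T T' : C) (m : ext T X) (i : hom X J) (p : hom J T)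
    (m' : ext T' X') (i' : hom X' J') (p' : hom J' T') (x : hom X X') :
  tri (ext_upper I) m i p -> I J' -> real m' i' p' ->
  exists x1 : hom T T', pull m' x1 = push x m.
Proof.
move=> [u r] IJ r'.
have [|k ->] := push_eq0_pull (e := push x m) r'; last by exists k.
by rewrite -pushM u.
Qed.

Lemma shift_lift_factors (X X' J J' T T' : C) (m : ext T X) (i : hom X J) (p : hom J T)
    (m' : ext T' X') (i' : hom X' J') (p' : hom J' T') (x : hom X X') (x1 : hom T T') :
  tri (ext_upper I) m i p -> I J' -> real m' i' p' ->
  pull m' x1 = push x m -> factors I x -> factors I x1.
Proof.
move=> [u r] IJ r' e fx.
have [|k ->] := pull_eq0_factor (g := x1) r'; first by rewrite e (upper_factors u fx).
by exists J', k, p'.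
Qed.

Variables (S Z : subcat C) (Q : quot I).
Hypothesis H : half_premutation I S Z.

Lemma reflect_lift_factors (U U' N N' S0 : C) (e : ext S0 U) (h : hom U N)
    (q : hom N S0) (h' : hom U' N') (u : hom U U') (su : hom N N') :
  tri (ext_upper I) e h q -> S S0 -> Z N' ->
  su \oc h = h' \oc u -> factors I u -> factors I su.
Proof.
move=> t SS ZN E /(piq_eq0 Q) fu; apply/(piq_eq0 Q).
apply: (zequiv_inj (zequiv_inflation Q H t SS) ZN).
by rewrite -piqM E piqM fu compm0 comp0m.
Qed.

End LiftLemmas.

Definition idquot_quot (C : addcat) (I : subcat C) : quot I.
Proof.
refine (@Quot C I (qhom I) (@qcomp C I) (@qpi C I) _ _ _ _).
- by move=> X Y f; exists (qrepr f); rewrite qreprK.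
- exact: qpiD.
- by move=> X Y W g f; rewrite qcompE.
- move=> X Y f; have e0 : qpi I (0 : hom X Y) = 0.
    by apply: (addrI (qpi I 0)); rewrite -qpiD !addr0.
  by rewrite -e0; apply: (iff_trans (qpi_eq _ _ _)); rewrite subr0.
Defined.

Definition idquot_pres (C : extricat) (I Z : subcat C) :
  @pres C I Z (idquot_quot I) (idquot I Z).
Proof.
refine (@Pres C I Z (idquot_quot I) (idquot I Z) (@so_ob C Z) (@so_in C Z) _
  (fun X Y f => f) _ _ _ _ _) => //.
- by move=> T ZT; exists (Subob ZT); exists (idm T); exact: is_iso1.
- by move=> X Y f; exists f.
Defined.
(** * The pretriangulated structure *)

(** By [rep_unique], a right triangle is isomorphic to the sequence of [std] on
    the same first morphism. *)
Lemma rtri_generated (C : extricat) (I S Z : subcat C) (Q : quot I)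
    (A : preaddcat) (P : pres Z Q A) (Sg : A -> A) (Sm : addfunctor Sg)
    (R : susp P Sm) (std : rseqs Sg) :
  half_premutation I S Z ->
  (forall (X Y W : A) (f : hom X Y) g h, std X Y W f g h -> rtri R f g h) ->
  (forall (X Y : A) (f : hom X Y), exists W g h, std X Y W f g h) ->
  forall (X Y W : A) (f : hom X Y) (g : hom Y W) (h : hom W (Sg X)),
    rtri R f g h <->
    exists (X' Y' W' : A) (f' : hom X' Y') (g' : hom Y' W') (h' : hom W' (Sg X')),
      std X' Y' W' f' g' h' /\ rseq_iso Sm f' g' h' f g h.
Proof.
move=> H stdR ex X Y W f g h; split; last first.
  by move=> [X' [Y' [W' [f' [g' [h' [s i]]]]]]]; exact: rtri_iso (stdR _ _ _ _ _ _ s) i.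
move=> T; have [W' [g' [h' s]]] := ex X Y f.
have [z [zi zg hz]] := rep_unique (stdR _ _ _ _ _ _ s) T.
exists X, Y, W', f, g', h'; split=> //.
exists (idm X), (idm Y), z; split; first by split=> //; exact: is_iso1.
by rewrite fmap1 !comp1m !compm1 zg hz.
Qed.

(** An isomorphism of left sequences has to be inverted componentwise, since its
    components change direction in the opposite category. *)
Lemma lseq_iso_op (A : preaddcat) (Om : A -> A) (Omm : addfunctor Om)
    (X Y Z : A) (h : hom (Om Z) X) (f : hom X Y) (g : hom Y Z)
    (X' Y' Z' : A) (h' : hom (Om Z') X') (f' : hom X' Y') (g' : hom Y' Z') :
  lseq_iso Omm h f g h' f' g' <->
  @rseq_iso (opcat A) Om (opfunctor Omm) Z Y X g f h Z' Y' X' g' f' h'.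
Proof.
have inv (U U' : A) (u : hom U U') : is_iso u ->
    exists v, [/\ is_iso v, v \oc u = idm U & u \oc v = idm U'].
  by move=> [v [e1 e2]]; exists v; split=> //; exists u.
split=> -[x [y [z [[xi yi zi] [e1 e2 e3]]]]].
  have [[x' [xi' x1 x2]] [y' [yi' y1 y2]] [z' [zi' z1 z2]]] :=
    And3 (inv _ _ _ xi) (inv _ _ _ yi) (inv _ _ _ zi).
  exists z', y', x'; split; first by split; apply/is_iso_op.
  split=> /=.
  - by rewrite -[LHS]comp1m -z1 -compA (compA z) e3 -!compA y2 compm1.
  - by rewrite -[LHS]comp1m -y1 -compA (compA y) e2 -!compA x2 compm1.
  - rewrite -[LHS]comp1m -x1 -compA (compA x) e1 -!compA -fmapM z2 fmap1.
    by rewrite compm1.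
move: xi yi zi e1 e2 e3 => /is_iso_op xi /is_iso_op yi /is_iso_op zi /= e1 e2 e3.
have [[x' [xi' x1 x2]] [y' [yi' y1 y2]] [z' [zi' z1 z2]]] :=
  And3 (inv _ _ _ xi) (inv _ _ _ yi) (inv _ _ _ zi).
exists z', y', x'; split=> //; split.
- by rewrite -[LHS]compm1 -(fmap1 Omm) -x2 fmapM -compA (compA h) e3 !compA z1 comp1m.
- by rewrite -[LHS]compm1 -z2 -compA (compA f) e2 !compA y1 comp1m.
- by rewrite -[LHS]compm1 -y2 -compA (compA g) e1 !compA x1 comp1m.
Qed.

Section Main.
Variables (C : extricat) (S Z V : subcat C).
Hypothesis M : premutation S Z V.
Variable ch : choices S Z V.
Local Notation I := (subcatI S Z).
Local Notation Q := (idquot_quot I).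
Local Notation P := (idquot_pres I Z).
Local Notation "\q f" := (piq Q f) (at level 8, f at level 2, format "\q  f").
Local Notation HR := (premutation_right M).
Local Notation HL := (premutation_left M).

Lemma up_functor_ex : exists upF : addfunctor (up M ch),
  induced upF (@up_lift C S Z V M ch).
Proof.
apply: induced_ex; rewrite /up_lift.
- move=> X X' f; apply: shift_lift_ex (up_tri (ch_up ch X)) _ (up_tri (ch_up ch X')).2.
  exact: (up_approx (ch_up ch X')).1.
- move=> X X' f f' e.
  apply: shift_lift_factors (up_tri (ch_up ch X)) _ (up_tri (ch_up ch X')).2 e.
  exact: (up_approx (ch_up ch X')).1.
- by move=> X X' f f' g g' e1 e2; rewrite pullBr pushBl e1 e2.
- by move=> X; rewrite pull1 push1.
- by move=> X Y W g f g' f' e1 e2; rewrite pullM pushM e1 -push_pull e2.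
Qed.

Lemma down_functor_ex : exists downF : addfunctor (down M ch),
  induced downF (@down_lift C S Z V M ch).
Proof.
apply: induced_ex; rewrite /down_lift.
- move=> X X' f.
  apply: (@shift_lift_ex (opE C) (opsub I) _ _ _ _ _ _ _ _ _ _ _ _ f
    (dn_tri (ch_down ch X')) _ (dn_tri (ch_down ch X)).2).
  exact: (dn_approx (ch_down ch X)).1.
- move=> X X' f f' e ff; apply/factors_op.
  apply: (@shift_lift_factors (opE C) (opsub I) _ _ _ _ _ _ _ _ _ _ _ _ f f'
    (dn_tri (ch_down ch X')) _ (dn_tri (ch_down ch X)).2 e).
    exact: (dn_approx (ch_down ch X)).1.
  exact/factors_op.
- by move=> X X' f f' g g' e1 e2; rewrite pullBr pushBl e1 e2.
- by move=> X; rewrite pull1 push1.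
- by move=> X Y W g f g' f' e1 e2; rewrite pullM pushM e2 push_pull e1.
Qed.

Lemma sigma_functor_ex : exists sigmaF : addfunctor (sigma ch),
  induced sigmaF (@sigma_lift C S Z V ch).
Proof.
apply: induced_ex; rewrite /sigma_lift.
- move=> U U' f.
  have [f' ->] := inflation_extend HR (sg_h (ch_sigma ch U') \oc f)
    (sg_tri (ch_sigma ch U)) (sg_SS (ch_sigma ch U)) (sg_Z (ch_sigma ch U')).
  by exists f'.
- move=> U U' f f' e.
  exact: (reflect_lift_factors Q HR (sg_tri (ch_sigma ch U)) (sg_SS _) (sg_Z _) e).
- by move=> X X' f f' g g' e1 e2; rewrite compBr compBl e1 e2.
- by move=> X; rewrite compm1 comp1m.
- by move=> X Y W g f g' f' e1 e2; rewrite -compA e2 !compA e1.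
Qed.

Lemma omega_functor_ex : exists omegaF : addfunctor (omega ch),
  induced omegaF (@omega_lift C S Z V ch).
Proof.
apply: induced_ex; rewrite /omega_lift.
- move=> T T' f.
  have [f' ef] := @inflation_extend (opE C) _ _ _ HL _ _ _ _ _ _ _
    (f \oc om_h (ch_omega ch T)) (om_tri (ch_omega ch T')) (om_VV (ch_omega ch T'))
    (om_Z (ch_omega ch T)).
  by exists f'.
- move=> T T' f f' e ff; apply/factors_op.
  apply: (@reflect_lift_factors (opE C) _ _ _ (opquot Q) HL _ _ _ _ _ _ _ _ _ f f'
    (om_tri (ch_omega ch T')) (om_VV _) (om_Z _) e).
  exact/factors_op.
- by move=> X X' f f' g g' e1 e2; rewrite compBr compBl e1 e2.
- by move=> X; rewrite compm1 comp1m.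
- by move=> X Y W g f g' f' e1 e2; rewrite compA e1 -!compA e2.
Qed.

Variables (upF : addfunctor (up M ch)) (sigmaF : addfunctor (sigma ch)).
Variables (downF : addfunctor (down M ch)) (omegaF : addfunctor (omega ch)).
Hypothesis upP : induced upF (@up_lift C S Z V M ch).
Hypothesis sigmaP : induced sigmaF (@sigma_lift C S Z V ch).
Hypothesis downP : induced downF (@down_lift C S Z V M ch).
Hypothesis omegaP : induced omegaF (@omega_lift C S Z V ch).

Lemma sigma_nat (U U' : subob (Util S Z)) (u : hom (U : C) (U' : C)) :
  @comp (qcat Q) _ _ _ (fmap sigmaF (cls I u)) \q (sg_h (ch_sigma ch U)) =
  \q (sg_h (ch_sigma ch U')) \oc \q u.
Proof.
have [[su e] E] := sigmaP u; rewrite (E su e).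
by rewrite -[RHS]piqM -e piqM.
Qed.

Lemma omega_nat (T T' : subob (Ttil S Z V)) (t : hom (T : C) (T' : C)) :
  @comp (qcat Q) _ _ _ \q (om_h (ch_omega ch T')) (fmap omegaF (cls I t)) =
  \q t \oc \q (om_h (ch_omega ch T)).
Proof.
have [[ot e] E] := omegaP t; rewrite (E ot e).
by rewrite -[RHS]piqM -e piqM.
Qed.

Lemma omega_cozequiv (T : subob (Ttil S Z V)) :
  @cozequiv C I Z Q (T : C) (omega ch T : C) \q (om_h (ch_omega ch T)).
Proof.
have t := om_tri (ch_omega ch T).
exact: (@zequiv_inflation (opE C) _ _ _ (opquot Q) HL _ _ _ _ _ _ t (om_VV _)).
Qed.

Definition sigma_susp : @susp C I Z Q (QZ S Z) P (Sig M ch) (fcomp sigmaF upF).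
Proof.
refine (@Susp C I Z Q (QZ S Z) P (Sig M ch) (fcomp sigmaF upF)
  (fun X => up_I (ch_up ch X)) (fun X => up_sh (ch_up ch X))
  (fun X => up_i (ch_up ch X)) (fun X => up_p (ch_up ch X))
  (fun X => up_lam (ch_up ch X)) (fun X => up_tri (ch_up ch X))
  (fun X => (up_approx (ch_up ch X)).1)
  (fun X => \q (sg_h (ch_sigma ch (up M ch X)))) _ _).
- move=> X; exact: (zequiv_inflation Q HR (sg_tri _) (sg_SS _)).
- move=> X X' x x0 x1 /= <- e.
  have [_ E] := @upP X X' x0.
  transitivity (@comp (qcat Q) _ _ _ 
      (fmap sigmaF (@cls C I (Util S Z) (up M ch X) (up M ch X') x1))
      \q (sg_h (ch_sigma ch (up M ch X)))); last first.
    exact: (@sigma_nat (up M ch X) (up M ch X') x1).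
  by rewrite -(E x1 e).
Defined.

Definition omega_susp : @susp (opE C) (opsub I) (opsub Z) (opquot Q) (opcat (QZ S Z))
  (oppres P) (Om M ch) (opfunctor (fcomp omegaF downF)).
Proof.
refine (@Susp (opE C) (opsub I) (opsub Z) (opquot Q) (opcat (QZ S Z)) (oppres P)
  (Om M ch) (opfunctor (fcomp omegaF downF))
  (fun X => dn_I (ch_down ch X)) (fun X => dn_sh (ch_down ch X))
  (fun X => dn_p (ch_down ch X)) (fun X => dn_i (ch_down ch X))
  (fun X => dn_lam (ch_down ch X)) (fun X => dn_tri (ch_down ch X))
  (fun X => (dn_approx (ch_down ch X)).1)
  (fun X => \q (om_h (ch_omega ch (down M ch X)))) _ _).
- by move=> X; exact: (omega_cozequiv (down M ch X)).
- move=> X X' x x0 x1 /= <- e.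
  have [_ E] := @downP X' X x0.
  transitivity (@comp (qcat Q) _ _ _ \q (om_h (ch_omega ch (down M ch X)))
    (fmap omegaF (@cls C I (Ttil S Z V) (down M ch X') (down M ch X) x1))); last first.
    exact: (@omega_nat (down M ch X') (down M ch X) x1).
  by rewrite -(E x1 e).
Defined.

Lemma std_rtri (X Y : subob Z) (a : hom (X : C) (Y : C)) :
  rtri sigma_susp (std_f S a) (std_g M ch a) (std_h M sigmaF a).
Proof.
pose D := ch_cone ch a; pose B := cn_bp D; have [t r] := cn_tri D.
have IJ := (up_approx (ch_up ch X)).1.
exists; exists (X : C) (B : C) (cn_ob D) (cn_ext D)
  (bin1 B \oc a + bin2 B \oc up_i (ch_up ch X)) (cn_b D) (idm _) (bpr1 B)
  \q (sg_h (ch_sigma ch (cn_so M ch a))) (cn_c D).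
- by split.
- exact: so_in.
- by apply: sub_biprod; [exact: so_in | exact: IJ.2].
- exact: is_iso1.
- exact: piq_bpr1_iso.
- exact: (zequiv_inflation Q HR (sg_tri _) (sg_SS _)).
- by rewrite push1 cn_cE.
- rewrite -piqM compDr !compA bpr1_in1 bpr1_in2 comp1m comp0m addr0.
  exact: (@compm1 (qcat Q)).
- rewrite -[RHS]piqM.
  transitivity (\q (sg_h (ch_sigma ch (cn_so M ch a)) \oc (cn_b D \oc bin1 B))
    \oc \q (bpr1 B)); first by [].
  rewrite (compA (sg_h _)) piqM -[LHS]compA piq_bin1_bpr1 ?compm1 //; exact: IJ.
- exact: (@sigma_nat (cn_so M ch a) (up M ch X) (cn_c D)).
Qed.

Lemma std_ltri (Y W : subob Z) (b : hom (Y : C) (W : C)) :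
  ltri omega_susp (lstd_h M omegaF b) (lstd_f M ch b) (lstd_g S b).
Proof.
pose D := ch_cocone ch b; pose B := cc_bp D; have [t r] := cc_tri D.
have IJ := (dn_approx (ch_down ch W)).1.
exists; apply: (@Rep (opE C) (opsub I) (opsub Z) (opquot Q) (opcat (QZ S Z))
  (oppres P) (Om M ch) _ omega_susp W Y (omega ch (cc_so M ch b)) _ _ _
  (W : C) (B : C) (cc_ob D) (cc_ext D)
  (b \oc bpr1 B + dn_p (ch_down ch W) \oc bpr2 B) (cc_a D) (idm (W : C)) (bin1 B)
  \q (om_h (ch_omega ch (cc_so M ch b))) (cc_c D)).
- by split.
- exact: so_in.
- by apply: (@sub_biprod _ Z); [exact: so_in | exact: IJ.2].
- exact: is_iso1.
- by apply/is_iso_op; exact: (piq_bin1_iso Q).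
- exact: (omega_cozequiv (cc_so M ch b)).
- by rewrite [RHS]push1; exact: cc_cE.
- have e : (b \oc bpr1 B + dn_p (ch_down ch W) \oc bpr2 B) \oc bin1 B = b.
    exact: copair_in1.
  have : \q (idm (W : C)) \oc \q b =
      \q (b \oc bpr1 B + dn_p (ch_down ch W) \oc bpr2 B) \oc \q (bin1 B).
    by rewrite -!piqM e comp1m.
  exact.
- have : \q (bin1 B) \oc \q (bpr1 B \oc cc_a D \oc om_h (ch_omega ch (cc_so M ch b))) =
      \q (cc_a D) \oc \q (om_h (ch_omega ch (cc_so M ch b))).
    by rewrite piqM piqM !compA piq_bin1_bpr1 ?comp1m //; exact: IJ.
  exact.
- exact: (@omega_nat (down M ch W) (cc_so M ch b) (cc_c D)).
Qed.

(** The standard triangles as inductive families: [nabla] and [delta] are their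
    closures under isomorphism. *)
Inductive right_std : rseqs (Sig M ch) :=
  RightStd (X Y : subob Z) (a : hom (X : C) (Y : C)) :
    @right_std X Y (sigma ch (cn_so M ch a)) (std_f S a) (std_g M ch a) (std_h M sigmaF a).

Inductive left_std : @rseqs (opcat (QZ S Z)) (Om M ch) :=
  LeftStd (Y W : subob Z) (b : hom (Y : C) (W : C)) :
    @left_std W Y (omega ch (cc_so M ch b)) (lstd_g S b) (lstd_f M ch b)
      (lstd_h M omegaF b).

Lemma nablaE (X Y W : QZ S Z) (f : hom X Y) (g : hom Y W) (h : hom W (Sig M ch X)) :
  rtri sigma_susp f g h <-> nabla sigmaF upF f g h.
Proof.
apply: iff_trans; first apply: (rtri_generated (std := right_std) HR).
- by move=> X1 Y1 W1 f1 g1 h1 [X0 Y0 a]; exact: std_rtri.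
- move=> X0 Y0 a; have [a0 ->] := piq_surj (Q := Q) a.
  do 3!eexists; exact: (RightStd a0).
split.
  by move=> [X' [Y' [W' [f' [g' [h' [[X0 Y0 a] i]]]]]]]; exists X0, Y0, a.
by move=> [X0 [Y0 [a i]]]; do 6!eexists; split; [exact: (RightStd a) | exact: i].
Qed.

Lemma deltaE (X Y W : QZ S Z) (h : hom (Om M ch W) X) (f : hom X Y) (g : hom Y W) :
  ltri omega_susp h f g <-> delta omegaF downF h f g.
Proof.
apply: iff_trans; first apply: (rtri_generated (std := left_std) HL).
- by move=> X1 Y1 W1 f1 g1 h1 [Y0 W0 b]; exact: std_ltri.
- move=> W0 Y0 b; have [b0 ->] := piq_surj (Q := Q) (b : @hom (QZ S Z) Y0 W0).
  do 3!eexists; exact: (LeftStd b0).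
split.
  move=> [X' [Y' [W' [f' [g' [h' [[Y0 W0 b] i]]]]]]]; exists Y0, W0, b.
  exact/lseq_iso_op.
move=> [Y0 [W0 [b i]]]; do 6!eexists; split; first exact: (LeftStd b).
exact/lseq_iso_op.
Qed.

Lemma nabla_delta_pretriangulated :
  exists adj : adjunction (fcomp sigmaF upF) (fcomp omegaF downF),
    adj_spec adj /\ pretriangulated adj (nabla sigmaF upF) (delta omegaF downF).
Proof.
have [adj adjE] := adjunction_ex sigma_susp omega_susp; exists adj; split.
  move=> X X' f f'; apply: (iff_trans (adjE _ _ _ _)).
  by apply: adjRP; rewrite piqM.
have -> : nabla sigmaF upF = rtri sigma_susp.
  do 6!(apply: functional_extensionality_dep => ?); apply: propext.
  apply: iff_sym; exact: nablaE.
have -> : delta omegaF downF = ltri omega_susp.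
  do 6!(apply: functional_extensionality_dep => ?); apply: propext.
  apply: iff_sym; exact: deltaE.
exact: (rtri_ltri_pretriangulated HR HL adjE).
Qed.

End Main.

Theorem theorem1p2 (C : extricat) (hC : skeletally_small C) (S Z V : subcat C)
    (M : premutation S Z V) :
  inhabited (choices S Z V) /\
  forall ch : choices S Z V,
    exists (upF : addfunctor (up M ch)) (sigmaF : addfunctor (sigma ch))
           (downF : addfunctor (down M ch)) (omegaF : addfunctor (omega ch))
           (adj : adjunction (fcomp sigmaF upF) (fcomp omegaF downF)),
      (induced upF (@up_lift C S Z V M ch) /\
       induced sigmaF (@sigma_lift C S Z V ch) /\
       induced downF (@down_lift C S Z V M ch) /\
       induced omegaF (@omega_lift C S Z V ch)) /\
      adj_spec adj /\
      pretriangulated adj (nabla sigmaF upF) (delta omegaF downF).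
Proof.
split=> [|ch]; first exact: choices_inhabited.
have [[upF upP] [sigmaF sigmaP]] := (up_functor_ex M ch, sigma_functor_ex M ch).
have [[downF downP] [omegaF omegaP]] := (down_functor_ex M ch, omega_functor_ex M ch).
have [adj adjP] := nabla_delta_pretriangulated upP sigmaP downP omegaP.
by exists upF, sigmaF, downF, omegaF, adj.
Qed.
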